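(* Assume the planar Furstenberg conjecture over prime fields (stated in the context) holds. Let $1\le k<n$ be integers and let $s,t$ be real numbers with $0\le s\le k$ and $0\le t\le (k+1)(n-k)$. Then for every $\lambda\in(0,1]$ and every $\varepsilon>0$ there is a constant $c>0$, depending only on $s,t,n,k,\lambda,\varepsilon$, such that for every prime $p$ and every $(s,t;n,k;\lambda)$-Furstenberg set $E\subset\mathbb{F}_p^n$, $$\#E\ge c\,p^{\mathbf{F}(s,t;n,k)-\varepsilon}.$$
   Context: $\mathbb{F}_p$ is the field with $p$ elements, $p$ prime. $A(k,\mathbb{F}_p^n)$ is the set of $k$-planes in $\mathbb{F}_p^n$, i.e. translates of $k$-dimensional linear subspaces. Furstenberg sets: for $0<\lambda\le 1$, a set $E\subset\mathbb{F}_p^n$ is an $(s,t;n,k;\lambda)$-Furstenberg set if $E=\bigcup_{V\in\mathcal{V}}Y(V)$, where $\mathcal{V}\subset A(k,\mathbb{F}_p^n)$ satisfies $\#\mathcal{V}\ge\lambda p^t$ and for each $V\in\mathcal{V}$, $Y(V)\subset V$ satisfies $\#Y(V)\ge\lambda p^s$. Planar Furstenberg conjecture over prime fields: for all $s\in(0,1]$, $t\in(0,2]$, $\lambda\in(0,1]$, $\varepsilon>0$ there is $c>0$ depending only on $s,t,\lambda,\varepsilon$ such that for every prime $p$, every $(s,t;2,1;\lambda)$-Furstenberg set $E\subset\mathbb{F}_p^2$ satisfies $\#E\ge c\,p^{\min\{s+t,\frac32 s+\frac12 t,s+1\}-\varepsilon}$. Furstenberg index $\mathbf{F}(s,t;n,k)$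 (for integers $1\le k<n$, real $0\le s\le k$, $0\le t\le(k+1)(n-k)$): (a) If $s=0$: $\mathbf{F}(0,t;n,k)=\max\{0,t-k(n-k)\}$. If $s>0$, write $s=d+\sigma$ with $d\in\{0,\dots,k-1\}$, $\sigma\in(0,1]$. (b) If $s>0$ and $t\in[0,(k-d-1)(n-k)]$: $\mathbf{F}(s,t;n,k)=s$. Otherwise ($s>0$ and $t\in((k-d-1)(n-k),(k+1)(n-k)]$) write uniquely $t=(k-d-1)(n-k)+(d+2)m+\tau$ with $m\in\{0,\dots,n-k-1\}$, $\tau\in(0,d+2]$, and set (c),(d) $\mathbf{F}(s,t;n,k)=s+m+\min\{\tau,\tfrac12(\sigma+\tau),1\}$ (which equals $s+m+1$ when $\tau\in(2,d+2]$). *)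

(* Defs.v *)
From mathcomp Require Import all_boot all_order all_algebra.
From mathcomp Require Import reals exp ring lra.

Set Implicit Arguments.
Unset Strict Implicit.
Unset Printing Implicit Defensive.

Import Order.TTheory GRing.Theory Num.Theory.
Local Open Scope ring_scope.

Definition kplane (p n k : nat) (V : {set 'rV['F_p]_n}) : Prop :=
  exists (W : {vspace 'rV['F_p]_n}) (x : 'rV['F_p]_n),
    \dim W = k /\ V = [set x + w | w in W].

Definition furstenberg_set (R : realType) (p n k : nat) (s t lambda : R)
    (E : {set 'rV['F_p]_n}) : Prop :=
  exists (VV : {set {set 'rV['F_p]_n}})
         (Y : {set 'rV['F_p]_n} -> {set 'rV['F_p]_n}),
    [/\ forall V, V \in VV -> kplane k V,
        lambda * p%:R `^ t <= #|VV|%:R,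
        forall V, V \in VV ->
          Y V \subset V /\ lambda * p%:R `^ s <= #|Y V|%:R
      & E = \bigcup_(V in VV) Y V].

Definition planar_furstenberg_conjecture (R : realType) : Prop :=
  forall s t lambda eps : R,
    0 < s <= 1 -> 0 < t <= 2 -> 0 < lambda <= 1 -> 0 < eps ->
    exists c : R, 0 < c /\
      forall p : nat, prime p ->
      forall E : {set 'rV['F_p]_2}, furstenberg_set 1 s t lambda E ->
        c * p%:R `^ (Num.min (s + t)
                       (Num.min (3%:R / 2%:R * s + 1 / 2%:R * t) (s + 1)) - eps)
          <= #|E|%:R.

(* For 0 < x, the unique natural number q such that q < x <= q + 1. *)
Definition lower_index (R : realType) (x : R) : nat := `|Num.ceil x|%N.-1.

(* With s = d + sigma, 0 < sigma <= 1, and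
   t = (k - d - 1)(n - k) + (d + 2) m + tau, 0 < tau <= d + 2,
   see [furstenberg_index_low] and [furstenberg_index_high]. *)
Definition furstenberg_index (R : realType) (s t : R) (n k : nat) : R :=
  if s == 0 then Num.max 0 (t - k%:R * (n%:R - k%:R))
  else
    let d := lower_index s in
    let sigma := s - d%:R in
    let t0 := (k%:R - d%:R - 1) * (n%:R - k%:R) in
    if t <= t0 then s
    else
      let m := lower_index ((t - t0) / (d%:R + 2%:R)) in
      let tau := t - t0 - (d%:R + 2%:R) * m%:R in
      s + m%:R + Num.min tau (Num.min ((sigma + tau) / 2%:R) 1).

Lemma lower_indexE (R : realType) (q : nat) (y : R) :
  0 < y <= 1 -> lower_index (q%:R + y) = q.
Proof.
move=> /andP[y0 y1]; rewrite /lower_index.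
suff -> : Num.ceil (q%:R + y) = q.+1%:Z by [].
apply/ceil_def; rewrite intrB -!pmulrn -natr1.
by apply/andP; split; lra.
Qed.

Lemma furstenberg_index_low (R : realType) (d : nat) (sigma t : R) (n k : nat) :
  0 < sigma <= 1 -> t <= (k%:R - d%:R - 1) * (n%:R - k%:R) ->
  furstenberg_index (d%:R + sigma) t n k = d%:R + sigma.
Proof.
move=> hs ht; rewrite /furstenberg_index lower_indexE// ht; case: eqP => // h.
by have := ler0n R d; lra.
Qed.

Lemma furstenberg_index_high (R : realType) (d m : nat) (sigma tau : R)
    (n k : nat) :
  0 < sigma <= 1 -> 0 < tau <= d%:R + 2%:R ->
  furstenberg_index (d%:R + sigma)
    ((k%:R - d%:R - 1) * (n%:R - k%:R) + (d%:R + 2%:R) * m%:R + tau) n k =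
  d%:R + sigma + m%:R + Num.min tau (Num.min ((sigma + tau) / 2%:R) 1).
Proof.
move=> hs /andP[tau0 taud]; rewrite /furstenberg_index lower_indexE//.
have d0 : 0 <= d%:R :> R := ler0n R d.
have d2 : 0 < d%:R + 2%:R :> R by lra.
have dm0 : 0 <= (d%:R + 2%:R) * m%:R :> R by rewrite mulr_ge0// ltW.
case: eqP => [h|_]; first by lra.
set t0 := (k%:R - d%:R - 1) * (n%:R - k%:R).
rewrite ifF; last by apply/negbTE; rewrite -ltNge; lra.
have -> : (t0 + (d%:R + 2%:R) * m%:R + tau - t0) / (d%:R + 2%:R)
          = m%:R + tau / (d%:R + 2%:R) by field; rewrite gt_eqF.
rewrite lower_indexE; last by rewrite divr_gt0//= ler_pdivrMr// mul1r.
have -> : t0 + (d%:R + 2%:R) * m%:R + tau - t0 - (d%:R + 2%:R) * m%:R = tau.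
  by ring.
by have -> : d%:R + sigma - d%:R = sigma by ring.
Qed.

(* Main.v *)
Require Import Defs.
From mathcomp Require Import all_boot all_order all_algebra finfield.
From mathcomp Require Import boolp reals exp.
From mathcomp Require Import ring lra.

Set Implicit Arguments.
Unset Strict Implicit.
Unset Printing Implicit Defensive.

Import Order.TTheory GRing.Theory Num.Theory.
Local Open Scope ring_scope.

(** Write q for the prime, and call a k-plane rich when it carries at least a
    fixed multiple of q^s points of E. The theorem bounds #E from below when
    there are about q^t rich planes. Four reductions move the parameters until
    only the planar hypothesis is left.

    Projecting along a direction ([furstenberg_bound_project]). A given k-plane
    of F^n contains a random direction with probability about q^(k-n), so some
    direction u is shared by about q^(t-(n-k)) rich planes. Projecting along u
    turns these into distinct (k-1)-planes of F^(n-1), and as long as s <= k-1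
    the points on a plane typically survive. Repeating this k-d-1 times brings k
    down to d+1 at the cost of (k-d-1)(n-k) in t, which is the shift built into
    the index; for s = 0 one continues until the planes are points.

    Hyperplanes ([furstenberg_bound_hyperplanes]), for k = d+1 and t >= d+2. On
    average a hyperplane contains q^(t-(d+2)) of the rich planes, and induction
    on n bounds E inside every hyperplane by a number r that depends on how many
    rich planes it contains. The second moment of point-hyperplane incidences
    ([rich_hyperplanes]) leaves two alternatives: either E is at least q r / 2,
    which raises the exponent by one while t drops by d+2, or the number of such
    hyperplanes times r^2 is at most of order q^(n-1) #E. The inequality
    [gain_tradeoff] says that the second alternative is never the worse one.
    This step accounts for the summand m of the index.

    Slicing ([furstenberg_bound_slice]), for t <= 2 and k >= 2. A random
    hyperplane section lowers n, k and s by one and divides #E by q. Two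
    distinct planes have the same section only if the hyperplane contains their
    intersection, so for at most q^k planes the sections rarely coincide. After
    d slices the planes are lines.

    Lines ([furstenberg_bound_lines]), for t <= 2. Project along a random
    direction to dimension n-1. When about q^u lines fall onto one image line,
    they lie in a common plane; the planar hypothesis inside that plane shows
    that the image line carries many more points than each single line did, and
    [planar_gain_project] says that this outweighs the loss in the number of
    lines. Iterating reaches the plane itself.

    All quantities that vary from plane to plane are made constant by
    restricting to a popular scale between q^(j dl) and q^((j+1) dl); there are
    boundedly many scales, and each choice costs only a factor q^dl, absorbed
    by the arbitrary loss eps in the exponent. *)

(** * Flats of a vector space over a finite field *)

(** The ternary operation x + c (y - z) makes sense without choosing an origin
    or a subspace, so that flatness passes to linear images and to
    intersections at once. *)
Definition flat (F : finFieldType) (n : nat) (V : {set 'rV[F]_n}) : Prop :=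
  forall (x y z : 'rV[F]_n) (c : F),
    x \in V -> y \in V -> z \in V -> x + c *: (y - z) \in V.

(** For a flat V this is its direction space; see [dirsP]. *)
Definition dirs (F : finFieldType) (n : nat) (V : {set 'rV[F]_n}) :
    {set 'rV[F]_n} :=
  [set u | [forall x in V, x + u \in V]].

(** Recording the dimension through the cardinality lets dimensions of images
    and sections be found by counting fibers. Over the prime field this is
    [kplane], by [kplaneE]. *)
Definition aplane (F : finFieldType) (n k : nat) (V : {set 'rV[F]_n}) : Prop :=
  [/\ V != set0, flat V & #|V| = (#|F| ^ k)%N].

Lemma card_row (F : finFieldType) (n : nat) : #|{: 'rV[F]_n}| = (#|F| ^ n)%N.
Proof. by rewrite card_mx mul1n. Qed.

Lemma card_col (F : finFieldType) (n : nat) : #|{: 'cV[F]_n}| = (#|F| ^ n)%N.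
Proof. by rewrite card_mx muln1. Qed.

Lemma row_free_inj (F : finFieldType) (k n : nat) (B : 'M[F]_(k, n)) :
  row_free B -> injective (fun y : 'rV_k => y *m B).
Proof.
move=> fB y z e.
by rewrite -[y]mulmx1 -[z]mulmx1 -(mulmxVp fB) !mulmxA e.
Qed.

Lemma param_aplane (F : finFieldType) (k n : nat) (B : 'M[F]_(k, n)) x0 :
  row_free B -> aplane k [set x0 + y *m B | y : 'rV[F]_k].
Proof.
move=> fB; split.
- by apply/set0Pn; exists (x0 + 0 *m B); apply/imsetP; exists 0.
- move=> _ _ _ c /imsetP[x _ ->] /imsetP[y _ ->] /imsetP[z _ ->].
  apply/imsetP; exists (x + c *: (y - z)) => //.
  rewrite mulmxDl -scalemxAl mulmxBl opprD addrACA subrr add0r.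
  by rewrite addrA.
- by rewrite card_imset ?card_row // => y z /addrI; apply: row_free_inj.
Qed.

(** The differences from x0 form a set closed under linear combinations; a row
    basis of the matrix listing them parametrizes the flat. *)
Lemma flat_param (F : finFieldType) (n : nat) (V : {set 'rV[F]_n}) x0 :
  flat V -> x0 \in V ->
  exists k (B : 'M[F]_(k, n)),
    row_free B /\ V = [set x0 + y *m B | y : 'rV[F]_k].
Proof.
move=> fV x0V; pose D := [set v | x0 + v \in V].
pose M := \matrix_(i < #|D|) (enum_val i : 'rV[F]_n).
have D0 : 0 \in D by rewrite inE addr0.
have DZ (c : F) v w : v \in D -> w \in D -> v + c *: w \in D.
  rewrite !inE => vD wD.
  by have := fV _ _ _ c vD wD x0V; rewrite [x0 + w]addrC addrK addrA.
exists (\rank M), (row_base M); split; first exact: row_base_free.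
apply/setP=> x; apply/idP/imsetP => [xV|[y _ ->]].
  have xD : x - x0 \in D by rewrite inE addrC subrK.
  have : (x - x0 <= row_base M)%MS.
    rewrite eq_row_base.
    have <- : row (enum_rank_in D0 (x - x0)) M = x - x0.
      by rewrite rowK enum_rankK_in.
    exact: row_sub.
  by case/submxP => y e; exists y => //; rewrite -e addrC subrK.
have : (y *m row_base M <= M)%MS.
  by rewrite (submx_trans (submxMl _ _)) // eq_row_base.
case/submxP => z ->; suff : z *m M \in D by rewrite inE.
rewrite mulmx_sum_row; elim/big_ind: _ => //.
  by move=> u v uD vD; rewrite -[v]scale1r DZ.
by move=> i _; rewrite rowK -[_ *: _]add0r DZ // enum_valP.
Qed.

Lemma aplane_param (F : finFieldType) (n k : nat) (V : {set 'rV[F]_n}) x0 :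
  aplane k V -> x0 \in V ->
  exists B : 'M[F]_(k, n),
    row_free B /\ V = [set x0 + y *m B | y : 'rV[F]_k].
Proof.
case=> V0 fV cV x0V; have [j [B [fB eV]]] := flat_param fV x0V.
have [_ _ cV'] := param_aplane x0 fB; rewrite -eV cV in cV'.
have ekj : j = k.
  by apply/eqP; rewrite -(eqn_exp2l _ _ (finNzRing_gt1 F)) -cV'.
by case: _ / ekj in cV' *; exists B.
Qed.

Lemma flat_aplane (F : finFieldType) (n : nat) (V : {set 'rV[F]_n}) :
  V != set0 -> flat V -> exists k, aplane k V.
Proof.
move=> /[dup] V0 /set0Pn[x0 x0V] fV; have [k [B [fB ->]]] := flat_param fV x0V.
by exists k; apply: param_aplane.
Qed.

(** Both notions are coset descriptions of a subspace; the dimensions agree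
    because a subspace of dimension k has p^k elements. *)
Lemma kplaneE (p n k : nat) (V : {set 'rV['F_p]_n}) :
  kplane k V <-> aplane k V.
Proof.
have q_gt1 := finNzRing_gt1 'F_p.
split=> [[W [x [dW ->]]]|pV].
  split.
  - by apply/set0Pn; exists (x + 0); apply: imset_f; rewrite mem0v.
  - move=> _ _ _ c /imsetP[u uW ->] /imsetP[v vW ->] /imsetP[w wW ->].
    apply/imsetP; exists (u + c *: (v - w)).
      by rewrite rpredD // rpredZ // rpredB.
    by rewrite opprD addrACA subrr add0r addrA.
  - by rewrite card_imset ?card_vspace ?dW // => u v /addrI.
have [/set0Pn[x xV] _ cV] := pV; have [B [fB eV]] := aplane_param pV xV.
pose W := limg (linfun (mulmxr B : 'rV['F_p]_k -> 'rV['F_p]_n)).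
have eVW : V = [set x + w | w in W].
  rewrite eV; apply/setP=> z; apply/imsetP/imsetP => [[y _ ->]|[w]].
    exists (y *m B) => //; rewrite -[y *m B]/(mulmxr B y) -lfunE.
    by rewrite memv_img ?memvf.
  by move=> /memv_imgP[y _ ->] ->; exists y => //; rewrite lfunE.
exists W, x; split=> //; apply/eqP; rewrite -(eqn_exp2l _ _ q_gt1) -card_vspace.
by rewrite -cV eVW card_imset // => u v /addrI.
Qed.

Lemma dirsP (F : finFieldType) (n : nat) (V : {set 'rV[F]_n}) x u :
  flat V -> x \in V -> (u \in dirs V) = (x + u \in V).
Proof.
move=> fV xV; rewrite inE; apply/forall_inP/idP => [/(_ x xV) //|xuV y yV].
have := fV _ _ _ 1 yV xuV xV.
by rewrite scale1r [x + u]addrC addrK.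
Qed.

Lemma dirsB (F : finFieldType) (n : nat) (V : {set 'rV[F]_n}) x y :
  flat V -> x \in V -> y \in V -> y - x \in dirs V.
Proof. by move=> fV xV yV; rewrite (dirsP _ fV xV) addrC subrK. Qed.

Lemma dirsZ (F : finFieldType) (n : nat) (V : {set 'rV[F]_n}) c u v :
  V != set0 -> flat V -> u \in dirs V -> v \in dirs V -> u + c *: v \in dirs V.
Proof.
move=> /set0Pn[x xV] fV; rewrite !(dirsP _ fV xV) => uV vV.
by have := fV _ _ _ c uV vV xV; rewrite [x + v]addrC addrK addrA.
Qed.

Lemma dirs0 (F : finFieldType) (n : nat) (V : {set 'rV[F]_n}) : 0 \in dirs V.
Proof. by rewrite inE; apply/forall_inP => x; rewrite addr0. Qed.

Lemma card_dirs (F : finFieldType) (n : nat) (V : {set 'rV[F]_n}) :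
  V != set0 -> flat V -> #|dirs V| = #|V|.
Proof.
move=> /set0Pn[x xV] fV.
have {2}-> : V = [set x + u | u in dirs V].
  apply/setP=> y; apply/idP/imsetP => [yV|[u uV ->]].
    by exists (y - x); rewrite ?dirsB // addrC subrK.
  by rewrite (dirsP _ fV xV) in uV.
by rewrite card_imset //; apply: addrI.
Qed.

(** * Hyperplanes and hyperplane sections *)

(** All fibers of a surjective additive map are translates of its kernel. *)
Lemma card_fiber (U W : finZmodType) (f : {additive U -> W}) (c : W) :
  (forall w, exists u, f u = w) ->
  (#|[set u | f u == c]| * #|W| = #|U|)%N.
Proof.
move=> sf.
have eqfib w : #|[set u | f u == w]| = #|[set u | f u == c]|.
  have [v fv] := sf (w - c).
  rewrite -(card_imset [set u | f u == c] (addrI v)); congr #|pred_of_set _|.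
  apply/setP=> u; rewrite inE; apply/eqP/imsetP => [fu|[x]].
    exists (u - v); last by rewrite addrC subrK.
    by rewrite inE raddfB /= fu fv opprB addrC subrK.
  by rewrite inE => /eqP fx ->; rewrite raddfD /= fv fx subrK.
rewrite -[RHS]sum1_card (partition_big f predT) //= mulnC -sum_nat_const.
by apply: eq_bigr => w _; rewrite -(eqfib w) sum1dep_card.
Qed.

(** The pair (a, b) stands for the equation x a = b. Allowing a = 0 makes the
    counts of pairs below exact powers of #|F|; a genuine hyperplane is then
    represented by #|F| - 1 pairs. *)
Definition hyperplane (F : finFieldType) (n : nat) (h : 'cV[F]_n * F) :
    {set 'rV[F]_n} :=
  [set x | (x *m h.1) 0 0 == h.2].

Lemma sub_hyperplane (F : finFieldType) (k n : nat) (B : 'M[F]_(k, n)) x0 h :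
  ([set x0 + y *m B | y : 'rV[F]_k] \subset hyperplane h) =
  (B *m h.1 == 0) && (h.2 == (x0 *m h.1) 0 0).
Proof.
apply/subsetP/andP => [sub|[/eqP B0 /eqP e] x].
  have e0 : (x0 *m h.1) 0 0 = h.2.
    by have := sub x0; rewrite inE => /(_ _)/eqP->//; apply/imsetP; exists 0;
       rewrite // mul0mx addr0.
  split; last by rewrite e0.
  apply/eqP/row_matrixP => i; rewrite row_mul row0.
  have := sub (x0 + row i B); rewrite inE mulmxDl !mxE /=.
  move=> /(_ _)/eqP H; apply/matrixP => a b; rewrite !ord1 [RHS]mxE.
  apply: (addrI (h.2)); rewrite addr0 -{1}e0.
  have <- : (x0 *m h.1 + row i B *m h.1) 0 0 = h.2.
    rewrite -mulmxDl; apply/eqP; have := sub (x0 + row i B); rewrite inE; apply.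
    by apply/imsetP; exists (delta_mx 0 i) => //; rewrite -rowE.
  by rewrite [RHS]mxE.
case/imsetP => y _ ->; rewrite inE mulmxDl -mulmxA B0 mulmx0 addr0.
by rewrite e.
Qed.

(** The linear part of the equation must annihilate the direction space, a
    condition of codimension k; the constant term is then determined. *)
Lemma card_hyperplanes_through (F : finFieldType) (k n : nat)
    (V : {set 'rV[F]_n}) : aplane k V ->
  (#|[set h | V \subset hyperplane h]| * #|F| ^ k = #|F| ^ n)%N.
Proof.
move=> pV; have [/set0Pn[x0 x0V] _ _] := pV.
have [B [fB ->]] := aplane_param pV x0V.
have -> : [set h | [set x0 + y *m B | y : 'rV[F]_k] \subset hyperplane h] =
    [set (a, (x0 *m a) 0 0) | a in [set a : 'cV[F]_n | mulmx B a == 0]].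
  apply/setP => -[a b]; rewrite inE sub_hyperplane /=; apply/andP/imsetP.
    by case=> Ba /eqP->; exists a; rewrite ?inE.
  by case=> a' + [-> ->]; rewrite inE.
rewrite card_imset; last by move=> a a' [].
rewrite -(card_col F k) -(card_col F n) card_fiber // => w.
by exists (pinvmx B *m w); rewrite /= mulmxA mulmxVp // mul1mx.
Qed.

Lemma aplane_point (F : finFieldType) (n : nat) (x : 'rV[F]_n) :
  aplane 0 [set x].
Proof.
split; last by rewrite cards1.
  by apply/set0Pn; exists x; rewrite inE.
by move=> a b d c; rewrite !inE => /eqP-> /eqP-> /eqP->; rewrite subrr scaler0 addr0.
Qed.

Lemma card_hyperplanes_point (F : finFieldType) (n : nat) (x : 'rV[F]_n) :
  (#|[set h | x \in hyperplane h]| = #|F| ^ n)%N.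
Proof.
have := card_hyperplanes_through (aplane_point x); rewrite muln1 => <-.
by congr #|pred_of_set _|; apply/setP => h; rewrite !inE sub1set inE.
Qed.

(** Two distinct points impose the same condition as the line through them. *)
Lemma card_hyperplanes_pair (F : finFieldType) (n : nat) (x y : 'rV[F]_n) :
  x != y ->
  (#|[set h | (x \in hyperplane h) && (y \in hyperplane h)]| * #|F| =
   #|F| ^ n)%N.
Proof.
move=> xy; have fB : row_free (y - x).
  by rewrite /row_free rank_rV subr_eq0 [y == x]eq_sym xy.
have := card_hyperplanes_through (param_aplane x fB); rewrite expn1 => <-.
congr (_ * _)%N; congr #|pred_of_set _|; apply/setP => h.
rewrite !inE sub_hyperplane mulmxBl.
apply/andP/andP => [[/eqP hx /eqP hy]|[/eqP /matrixP/(_ 0 0)]].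
  split; last by rewrite hx.
  apply/eqP/matrixP => i j; rewrite !ord1; have := hx; have := hy; rewrite !mxE.
  by move=> -> ->; rewrite subrr.
rewrite !mxE => /eqP; rewrite subr_eq0 => /eqP e /eqP ->.
by rewrite e eqxx.
Qed.

Lemma col_neq0 (F : finFieldType) (n : nat) (c : 'cV[F]_n) :
  c != 0 -> exists i, c i 0 != 0.
Proof.
move=> c0; apply/existsP; apply: contraNT c0; rewrite negb_exists => /forallP H.
by apply/eqP/colP => i; rewrite [RHS]mxE; apply/eqP; have := H i; rewrite negbK.
Qed.

(** A linear form that is not constant on V takes every value equally often on
    V. *)
Lemma aplane_section (F : finFieldType) (n k : nat) (V : {set 'rV[F]_n}) h u :
  aplane k.+1 V -> u \in dirs V -> u *m h.1 != 0 ->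
  aplane k (V :&: hyperplane h).
Proof.
move=> pV uV uh; have [/set0Pn[x0 x0V] fV cV] := pV.
have q0 : (0 < #|F|)%N by rewrite (leq_trans _ (finNzRing_gt1 F)).
have flatI : flat (V :&: hyperplane h).
  move=> x y z c /setIP[xV xh] /setIP[yV yh] /setIP[zV zh].
  rewrite inE fV //=; move: xh yh zh; rewrite !inE mulmxDl -scalemxAl mulmxBl.
  rewrite !mxE; move=> /eqP-> /eqP-> /eqP->.
  by rewrite subrr mulr0 addr0.
have [B [fB eV]] := aplane_param pV x0V.
have Bh : B *m h.1 != 0.
  apply: contraNneq uh => B0; move: uV; rewrite (dirsP _ fV x0V) eV.
  by case/imsetP => y _ /addrI ->; rewrite -mulmxA B0 mulmx0.
have cI : (#|V :&: hyperplane h| * #|F| = #|F| ^ k.+1)%N.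
  rewrite -(card_row F k.+1).
  have sf (w : 'M[F]_1) : exists y : 'rV_k.+1, mulmxr (B *m h.1) y = w.
    have [i hi] := col_neq0 Bh.
    exists ((w 0 0 / (B *m h.1) i 0) *: delta_mx 0 i).
    rewrite /= -scalemxAl -rowE; apply/matrixP => a b.
    by rewrite !ord1 mxE [X in _ * X]mxE divfK.
  have := card_fiber ((h.2)%:M - x0 *m h.1) sf.
  rewrite card_mx mul1n expn1 => <-; congr (_ * _)%N; set S := [set _ | _].
  have -> : V :&: hyperplane h = [set x0 + y *m B | y in S].
    apply/setP => x; apply/setIP/imsetP.
      rewrite {1}eV => -[/imsetP[y _ ->]]; rewrite inE => /eqP e.
      exists y => //; rewrite inE /= mulmxA.
      apply/eqP/matrixP => i j; rewrite !ord1 -e mulmxDl !mxE eqxx mulr1n.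
      by rewrite [X in X - _]addrC addrK.
    case=> y + ->; rewrite inE /= mulmxA => /eqP e; split.
      by rewrite eV; apply/imsetP; exists y.
    by rewrite inE mulmxDl e addrC subrK mxE eqxx mulr1n.
  by rewrite card_imset // => y z /addrI; apply: row_free_inj.
have {}cI : #|V :&: hyperplane h| = (#|F| ^ k)%N.
  by apply/eqP; rewrite -(eqn_pmul2r q0) cI expnSr.
by split=> //; rewrite -card_gt0 cI expn_gt0 q0.
Qed.

(** The intersection is a flat, hence has #|F|^j points for some j, and it is
    a proper subset of a set with #|F|^(k+1) points. *)
Lemma card_aplane_cap (F : finFieldType) (n k : nat) (V V' : {set 'rV[F]_n}) :
  aplane k.+1 V -> aplane k.+1 V' -> V != V' -> (#|V :&: V'| <= #|F| ^ k)%N.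
Proof.
move=> [_ fV cV] [_ fV' cV'] neq.
have [->|I0] := eqVneq (V :&: V') set0; first by rewrite cards0.
have fI : flat (V :&: V').
  move=> x y z c /setIP[xV xh] /setIP[yV yh] /setIP[zV zh].
  by rewrite inE fV ?fV'.
have [j [_ _ cI]] := flat_aplane I0 fI; rewrite cI.
have q1 := finNzRing_gt1 F.
rewrite leq_exp2l // -ltnS -(ltn_exp2l _ _ q1) -cI -cV.
apply: proper_card; rewrite properE subsetIl /=.
apply: contra neq => sV; rewrite eqEcard cV cV' leqnn andbT.
by apply: subset_trans sV (subsetIr _ _).
Qed.

(** * Linear images, projections and cylinders *)

Definition mximage (F : finFieldType) (n m : nat) (A : 'M[F]_(n, m))
    (V : {set 'rV[F]_n}) : {set 'rV[F]_m} := [set x *m A | x in V].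

Lemma flat_image (F : finFieldType) (n m : nat) (A : 'M[F]_(n, m)) V :
  flat V -> flat (mximage A V).
Proof.
move=> fV _ _ _ c /imsetP[x xV ->] /imsetP[y yV ->] /imsetP[z zV ->].
apply/imsetP; exists (x + c *: (y - z)); first exact: fV.
by rewrite mulmxDl -scalemxAl mulmxBl.
Qed.

Lemma aplane_image_inj (F : finFieldType) (n m k : nat) (A : 'M[F]_(n, m)) V :
  aplane k V -> {in V &, injective (fun x => x *m A)} -> aplane k (mximage A V).
Proof.
move=> [V0 fV cV] iV; split; last by rewrite card_in_imset.
  by rewrite /mximage imset_eq0.
exact: flat_image.
Qed.

(** A flat of dimension r can be identified linearly with F^r; bounds proved
    in F^r thus apply inside r-flats of larger spaces. *)
Lemma aplane_coords (F : finFieldType) (n r : nat) (S : {set 'rV[F]_n}) :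
  aplane r S -> exists A : 'M[F]_(n, r), {in S &, injective (fun x => x *m A)}.
Proof.
move=> pS; have [/set0Pn[x0 x0S] _ _] := pS.
have [B [fB ->]] := aplane_param pS x0S; exists (pinvmx B).
move=> _ _ /imsetP[y _ ->] /imsetP[z _ ->].
by rewrite !mulmxDl -!mulmxA mulmxVp // !mulmx1 => /addrI ->.
Qed.

Definition projects_along (F : finFieldType) (n m : nat) (A : 'M[F]_(n, m))
    (u : 'rV[F]_n) : Prop :=
  forall x, x *m A = 0 <-> exists c, x = c *: u.

Lemma exists_projection (F : finFieldType) (n : nat) (u : 'rV[F]_n.+1) :
  u != 0 -> exists A : 'M[F]_(n.+1, n), projects_along A u.
Proof.
move=> u0; have rk : \rank (cokermx u) = n.
  by rewrite mxrank_coker rank_rV u0 subn1.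
have [C [D [fD eCD]]] : exists (C : 'M[F]_(n.+1, n)) (D : 'M_(n, n.+1)),
    row_free D /\ C *m D = cokermx u.
  have := conj (row_base_free (cokermx u)) (mulmx_base (cokermx u)).
  move: (col_base _) (row_base _); move: (\rank _) rk => r er.
  by case: n / er u {u0} => u C D CD; exists C, D.
exists C => x; split=> [e|[c ->]].
  by apply/sub_rVP; rewrite submxE -eCD mulmxA e mul0mx.
apply: (row_free_inj fD).
by rewrite mul0mx -mulmxA eCD -scalemxAl mulmx_coker scaler0.
Qed.

Lemma projects_eq (F : finFieldType) (n m : nat) (A : 'M[F]_(n, m)) u x y :
  projects_along A u -> (x *m A = y *m A <-> exists c, x = y + c *: u).
Proof.
move=> pA; split=> [e|[c ->]].
  have /pA[c e'] : (x - y) *m A = 0 by rewrite mulmxBl e subrr.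
  by exists c; rewrite -e' addrC subrK.
by rewrite mulmxDl (iffRL (pA (c *: u))) ?addr0 //; exists c.
Qed.

Lemma dirs_add (F : finFieldType) (n : nat) (V : {set 'rV[F]_n}) x u c :
  V != set0 -> flat V -> u \in dirs V -> x \in V -> x + c *: u \in V.
Proof.
move=> V0 fV uV xV; rewrite -(dirsP _ fV xV) -[c *: u]add0r.
by rewrite dirsZ // dirs0.
Qed.

(** Two points of V with the same image differ by a multiple of u, so u would
    be a direction of V. *)
Lemma projection_inj_on (F : finFieldType) (n m k : nat) (A : 'M[F]_(n, m)) u V :
  projects_along A u -> aplane k V -> u \notin dirs V ->
  {in V &, injective (fun x => x *m A)}.
Proof.
move=> pA [V0 fV _] uV x y xV yV /= /(projects_eq _ _ pA)[c e].
have [c0|c0] := eqVneq c 0; first by rewrite e c0 scale0r addr0.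
case/negP: uV; have -> : u = 0 + c^-1 *: (x - y).
  by rewrite e [y + _]addrC addrK scalerA mulVf // scale1r add0r.
by rewrite dirsZ ?dirs0 // dirsB.
Qed.

(** The fibers of the projection inside V are full lines in the direction u. *)
Lemma aplane_image_proj (F : finFieldType) (n m k : nat) (A : 'M[F]_(n, m)) u V :
  projects_along A u -> u != 0 -> aplane k.+1 V -> u \in dirs V ->
  aplane k (mximage A V).
Proof.
move=> pA u0 [V0 fV cV] uV.
have q0 : (0 < #|F|)%N by rewrite (leq_trans _ (finNzRing_gt1 F)).
split; [by rewrite /mximage imset_eq0|exact: flat_image|].
have : (\sum_(z in mximage A V) #|[set x in V | x *m A == z]| =
        #|mximage A V| * #|F|)%N.
  rewrite -sum_nat_const; apply: eq_bigr => _ /imsetP[x xV ->].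
  rewrite -(@card_imset _ _ (fun c : F => x + c *: u)); last first.
    move=> c c' /addrI /eqP; rewrite -subr_eq0 -scalerBl scaler_eq0 (negbTE u0).
    by rewrite orbF subr_eq0 => /eqP.
  apply: eq_card => y; rewrite inE; apply/andP/imsetP.
    by case=> yV /eqP /(projects_eq _ _ pA)[c ->]; exists c.
  case=> c _ ->; rewrite dirs_add //; split=> //.
  by apply/eqP; apply/(projects_eq _ _ pA); exists c.
move=> e; apply/eqP; rewrite -(eqn_pmul2r q0) -e -expnSr -cV -sum1_card.
rewrite (partition_big (fun x => x *m A) (mem (mximage A V))) /=; last first.
  by move=> x xV; apply: imset_f.
by apply/eqP; apply: eq_bigr => z _; rewrite sum1dep_card.
Qed.

(** A flat invariant under translation by u is the full preimage of its image;
    distinct such flats therefore have distinct images. *)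
Lemma image_proj_inj (F : finFieldType) (n m : nat) (A : 'M[F]_(n, m)) u V V' :
  projects_along A u -> V' != set0 -> flat V' -> u \in dirs V' ->
  mximage A V \subset mximage A V' -> V \subset V'.
Proof.
move=> pA V0 fV' uV' /subsetP sub; apply/subsetP => x xV.
have /imsetP[y yV] := sub _ (imset_f _ xV).
by move=> /(projects_eq _ _ pA)[c ->]; apply: dirs_add.
Qed.

(** The union of the translates of V by multiples of v: the flat spanned by V
    and the direction v. *)
Definition cylinder (F : finFieldType) (n : nat) (V : {set 'rV[F]_n}) v :
    {set 'rV[F]_n} := [set x | [exists c, x - c *: v \in V]].

Lemma sub_cylinder (F : finFieldType) (n : nat) (V : {set 'rV[F]_n}) v :
  V \subset cylinder V v.
Proof.
apply/subsetP => x xV; rewrite inE; apply/existsP; exists 0.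
by rewrite scale0r subr0.
Qed.

Lemma aplane_cylinder (F : finFieldType) (n k : nat) (V : {set 'rV[F]_n}) v :
  aplane k V -> v \notin dirs V -> aplane k.+1 (cylinder V v).
Proof.
move=> [V0 fV cV] vV; split.
- by apply: contraNneq V0 => c0; rewrite -subset0 -c0 sub_cylinder.
- move=> x y z c; rewrite !inE => /existsP[a xa] /existsP[b yb] /existsP[d zd].
  apply/existsP; exists (a + c * (b - d)).
  have := fV _ _ _ c xa yb zd; congr (_ \in V).
  by apply/rowP => i; rewrite !mxE; ring.
- have -> : cylinder V v = [set xc.1 + xc.2 *: v | xc in setX V [set: F]].
    apply/setP => x; rewrite inE; apply/existsP/imsetP => [[c xc]|[[y c]]].
      by exists (x - c *: v, c); rewrite ?inE ?xc //= subrK.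
    by rewrite !inE andbT /= => yV ->; exists c; rewrite addrK.
  rewrite card_in_imset ?cardsX ?cardsT ?cV ?expnSr //.
  move=> [x c] [y d]; rewrite !inE !andbT /= => xV yV e.
  have e' : x - y = (d - c) *: v.
    by apply/eqP; rewrite subr_eq scalerBl addrAC [_ + y]addrC -e addrK.
  have [dc|dc] := eqVneq d c.
    by move: e'; rewrite dc subrr scale0r => /eqP; rewrite subr_eq0 => /eqP->.
  case/negP: vV; have -> : v = 0 + (d - c)^-1 *: (x - y).
    by rewrite e' add0r scalerA mulVf ?scale1r // subr_eq0.
  by rewrite dirsZ ?dirs0 // dirsB.
Qed.

Lemma image_cylinder (F : finFieldType) (n m : nat) (A : 'M[F]_(n, m)) v V :
  projects_along A v -> mximage A (cylinder V v) = mximage A V.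
Proof.
move=> pA; apply/setP => z; apply/imsetP/imsetP => -[x xV ->]; last first.
  by exists x => //; apply: (subsetP (sub_cylinder _ _)).
move: xV; rewrite inE => /existsP[c xV]; exists (x - c *: v) => //.
by apply/(projects_eq _ _ pA); exists c; rewrite subrK.
Qed.

Lemma sub_cylinder_image (F : finFieldType) (n m : nat) (A : 'M[F]_(n, m)) v V V' :
  projects_along A v -> mximage A V' = mximage A V -> V' \subset cylinder V v.
Proof.
move=> pA e; apply/subsetP => x xV; rewrite inE; apply/existsP.
have : x *m A \in mximage A V by rewrite -e; apply: imset_f.
case/imsetP => y yV /(projects_eq _ _ pA)[c ->]; exists c.
by rewrite addrK.
Qed.

(** A point x of V' outside V, together with a point y of V, forces v to be a
    multiple of x - y - d for some direction d of V. *)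
Lemma card_cylinders_through (F : finFieldType) (n : nat)
    (V V' : {set 'rV[F]_n}) : V != set0 -> flat V -> ~~ (V' \subset V) ->
  (#|[set v | (v \notin dirs V) && (V' \subset cylinder V v)]| <= #|F| * #|V|)%N.
Proof.
move=> V0 fV /subsetPn[x xV' xV]; have /set0Pn[y yV] := V0.
rewrite -(card_dirs V0 fV) -[#|F|]cardsT -cardsX.
pose f cd : 'rV[F]_n := cd.1 *: (x - y - cd.2).
apply: leq_trans (leq_imset_card f _); apply: subset_leq_card.
apply/subsetP => v; rewrite inE => /andP[vV /subsetP/(_ x xV')].
rewrite inE => /existsP[c xc]; have c0 : c != 0.
  by apply: contraNneq xV => c0; rewrite c0 scale0r subr0 in xc.
apply/imsetP; exists (c^-1, x - c *: v - y).
  by rewrite in_setX in_setT dirsB.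
rewrite /f /=; have -> : x - y - (x - c *: v - y) = c *: v.
  by rewrite opprB addrA subrK opprB addrC subrK.
by rewrite scalerA mulVf // scale1r.
Qed.

(** * Counting and averaging *)

(** Cauchy-Schwarz against the constant function, in the form of nonnegativity
    of the variance. *)
Lemma sum_sqr_le (R : realFieldType) (T : finType) (Z : {set T}) (x : T -> R) :
  (\sum_(z in Z) x z) ^+ 2 <= #|Z|%:R * \sum_(z in Z) x z ^+ 2.
Proof.
have [->|Z0] := eqVneq Z set0; first by rewrite !big_set0 cards0 expr0n mul0r.
set S := \sum_(z in Z) x z.
have N0 : 0 < #|Z|%:R :> R by rewrite ltr0n card_gt0.
have : 0 <= \sum_(z in Z) (x z - S / #|Z|%:R) ^+ 2.
  by apply: sumr_ge0 => z _; apply: sqr_ge0.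
have -> : \sum_(z in Z) (x z - S / #|Z|%:R) ^+ 2 =
          \sum_(z in Z) x z ^+ 2 - S ^+ 2 / #|Z|%:R.
  under eq_bigr do rewrite sqrrB.
  rewrite big_split sumrB /= sumr_const sumrMnl -mulr_suml -/S.
  rewrite -mulr_natl; field; exact: lt0r_neq0.
by rewrite subr_ge0 ler_pdivrMr // mulrC.
Qed.

Definition collisions (T T' : finType) (f : T -> T') (A : {set T}) :
    {set T * T} :=
  [set xy in setX A A | (xy.1 != xy.2) && (f xy.1 == f xy.2)].

(** Cauchy-Schwarz over the fibers: a map with few coincidences has a large
    image. This is how lower bounds for projections and sections are obtained
    throughout. *)
Lemma card_imset_collisions (R : realFieldType) (T T' : finType) (f : T -> T')
    (A : {set T}) :
  #|A|%:R ^+ 2 <= #|f @: A|%:R * (#|A|%:R + #|collisions f A|%:R) :> R.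
Proof.
have cA : #|A|%:R = \sum_(z in f @: A) #|[set x in A | f x == z]|%:R :> R.
  rewrite -sum1_card (partition_big f (mem (f @: A))) /=; last first.
    by move=> x xA; apply: imset_f.
  by rewrite natr_sum; apply: eq_bigr => z _; rewrite sum1dep_card.
have -> : #|A|%:R + #|collisions f A|%:R =
    \sum_(z in f @: A) #|[set x in A | f x == z]|%:R ^+ 2 :> R.
  rewrite -natrD; under eq_bigr do rewrite -natrX.
  rewrite -natr_sum; congr _%:R.
  have <- : #|[set xy in setX A A | f xy.1 == f xy.2]| =
            (#|A| + #|collisions f A|)%N.
    rewrite -(cardsID [set xy : T * T | xy.1 == xy.2]); congr (_ + _)%N.
      rewrite -(@card_imset _ _ (fun x : T => (x, x))); last by move=> x y [].
      apply: eq_card => -[x y]; rewrite !inE /=; apply/andP/imsetP.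
        case=> /andP[/andP[xA _] _] /eqP <-; by exists x.
      by case=> z zA [-> ->]; rewrite zA eqxx.
    apply: eq_card => -[x y]; rewrite !inE /=.
    by case: (x == y); rewrite ?andbF ?andbT.
  rewrite -sum1dep_card (partition_big (fun xy => f xy.1) (mem (f @: A))) /=.
    apply: eq_bigr => z _; rewrite sum1dep_card -mulnn -cardsX.
    apply: eq_card => -[x y]; rewrite !inE /=.
    apply/andP/andP => [[/andP[/andP[-> ->]] /eqP <- /eqP <-]|]; rewrite ?eqxx //.
    by case=> /andP[-> /eqP->] /andP[-> /eqP->]; rewrite eqxx.
  by move=> -[x y]; rewrite !inE /= => /andP[/andP[xA _] _]; apply: imset_f.
by rewrite cA; apply: sum_sqr_le.
Qed.

Lemma markov_card (R : realFieldType) (T : finType) (I : {set T}) (x : T -> R)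
    (th : R) : (forall i, i \in I -> 0 <= x i) ->
  #|[set i in I | th <= x i]|%:R * th <= \sum_(i in I) x i.
Proof.
move=> x0; rewrite (bigID (fun i => th <= x i)) /=.
have rest0 : 0 <= \sum_(i in I | ~~ (th <= x i)) x i.
  by apply: sumr_ge0 => i /andP[iI _]; apply: x0.
apply: le_trans (_ : \sum_(i in I | th <= x i) x i <= _); last by rewrite lerDl.
rewrite mulr_natl -sumr_const (eq_bigl (fun i => (i \in I) && (th <= x i))).
  by apply: ler_sum => i /andP[].
by move=> i; rewrite inE.
Qed.

Lemma double_count (S T : finType) (A : {set S}) (B : {set T}) (P : S -> T -> bool) :
  (\sum_(x in A) #|[set y in B | P x y]| =
   \sum_(y in B) #|[set x in A | P x y]|)%N.
Proof.
transitivity (\sum_(x in A) \sum_(y in B) (P x y : nat))%N.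
  apply: eq_bigr => x _; rewrite -sum1dep_card big_mkcondr.
  by apply: eq_bigr => y _; case: (P x y).
rewrite exchange_big /=; apply: eq_bigr => y _.
rewrite -sum1dep_card big_mkcondr.
by apply: eq_bigr => x _; case: (P x y).
Qed.

Lemma subset_of_card (T : finType) (W : {set T}) m :
  (m <= #|W|)%N -> exists2 V : {set T}, V \subset W & #|V| = m.
Proof.
move=> mW; exists [set x in take m (enum W)].
  by apply/subsetP => x; rewrite inE => /mem_take; rewrite mem_enum.
rewrite cardsE; have /card_uniqP -> := take_uniq m (enum_uniq W).
by rewrite size_take -cardE; case: ltngtP mW.
Qed.

Lemma average_ge (R : realFieldType) (T : finType) (I : {set T}) (f : T -> R) th :
  I != set0 -> #|I|%:R * th <= \sum_(i in I) f i ->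
  exists2 i, i \in I & th <= f i.
Proof.
move=> /set0Pn[i0 i0I] le; apply/exists_inP; apply: contraLR le.
rewrite negb_exists_in -ltNge => /forall_inP H.
rewrite mulr_natl -sumr_const; apply: ltr_sum.
  by apply/hasP; exists i0; rewrite // mem_index_enum.
by move=> i iI; rewrite ltNge; apply: H.
Qed.

(** The quantitative form of [card_imset_collisions]. If m >= a Q elements
    have at most C m^2 / K coincidences, then their image of size X satisfies
    1/X <= 1/m + C/K, which is at most (1/a + C)/Q since Q <= K. *)
Lemma few_collisions_large_image (R : realFieldType) (a C Q K m coll X : R) :
  0 < a -> 0 <= C -> 0 < Q <= K -> a * Q <= m ->
  coll <= C * m ^+ 2 / K -> 0 <= X -> m ^+ 2 <= X * (m + coll) ->
  a / (1 + C * a) * Q <= X.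
Proof.
move=> a0 C0 /andP[Q0 QK] am cC X0 mX.
have m0 : 0 < m by apply: lt_le_trans am; apply: mulr_gt0.
have Ca : 0 < 1 + C * a by have := mulr_ge0 C0 (ltW a0); lra.
have K0 : 0 < K by lra.
have : m ^+ 2 <= X * (m + C * m ^+ 2 / Q).
  apply: le_trans mX _; apply: ler_wpM2l => //; rewrite lerD2l.
  apply: le_trans cC _; rewrite ler_wpM2l ?mulr_ge0 ?sqr_ge0 ?(ltW m0) //.
  by rewrite lef_pV2 ?posrE.
have -> : X * (m + C * m ^+ 2 / Q) = m * (X * (1 + C * m / Q)).
  by field; rewrite gt_eqF.
rewrite expr2 ler_pM2l // => mX'.
have : m * Q <= X * (Q + C * m).
  have -> : X * (Q + C * m) = X * (1 + C * m / Q) * Q by field; rewrite gt_eqF.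
  by rewrite ler_pM2r.
move=> h; rewrite mulrAC ler_pdivrMr // leNgt; apply/negP => lt.
have hC : C * m * (X * (1 + C * a)) <= C * m * (a * Q).
  by rewrite ler_wpM2l ?(mulr_ge0 C0 (ltW m0)) // (ltW lt).
have h1 : m * Q * (1 + C * a) <= X * (Q + C * m) * (1 + C * a).
  by rewrite ler_pM2r.
have h2 : X * (1 + C * a) * Q < a * Q * Q by rewrite ltr_pM2r.
have h3 : m * Q < a * Q * Q.
  have e1 : m * Q * (1 + C * a) = m * Q + C * m * (a * Q) by ring.
  have e2 : X * (Q + C * m) * (1 + C * a) =
            X * (1 + C * a) * Q + C * m * (X * (1 + C * a)) by ring.
  by rewrite e1 e2 in h1; lra.
by move: h3; rewrite ltr_pM2r // ltNge am.
Qed.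

(** Pigeonhole: among boundedly many classes covering I, one carries a
    proportional share of the sum. *)
Lemma sum_over_scales (R : realFieldType) (T : finType) (I : {set T}) (x : T -> R)
    (J : nat) (sc : T -> 'I_J.+1 -> bool) :
  (forall i, i \in I -> 0 <= x i) ->
  (forall i, i \in I -> exists j, sc i j) ->
  exists j, \sum_(i in I) x i <= J.+1%:R * \sum_(i in I | sc i j) x i.
Proof.
move=> x0 ex.
have I0 : [set: 'I_J.+1] != set0 by apply/set0Pn; exists ord0; rewrite inE.
have [|j _ h] := @average_ge R _ [set: 'I_J.+1]
   (fun j => \sum_(i in I | sc i j) x i) ((\sum_(i in I) x i) / J.+1%:R) I0.
- rewrite cardsT card_ord mulrC divfK ?pnatr_eq0 //.
  under [leRHS]eq_bigr do rewrite big_mkcondr.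
  rewrite exchange_big /=; apply: ler_sum => i iI; have [j hj] := ex i iI.
  rewrite (bigD1 j) ?inE //= hj lerDl; apply: sumr_ge0 => j' _.
  by case: ifP => // _; apply: x0.
- by exists j; rewrite mulrC -ler_pdivrMr // ltr0n.
Qed.

(** * Powers and scales *)

Lemma powD (R : realType) (q x y : R) : 0 < q -> q `^ (x + y) = q `^ x * q `^ y.
Proof. by move=> q0; rewrite powRD // (gt_eqF q0) implybT. Qed.

Lemma pow_large (R : realType) (C x : R) :
  0 < x -> exists P : R, forall q, P <= q -> C <= q `^ x.
Proof.
move=> x0; have [C0|C0] := leP C 0.
  by exists 0 => q _; apply: le_trans C0 (powR_ge0 _ _).
exists (C `^ x^-1) => q Pq.
rewrite -[C]powRr1 ?(ltW C0) // -(mulVf (lt0r_neq0 x0)) powRrM.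
by apply: (ge0_ler_powR (ltW x0)); rewrite ?nnegrE ?(le_trans _ Pq) ?powR_ge0.
Qed.

Lemma pow_le (R : realType) (q c c' x y : R) :
  1 <= q -> 0 <= c <= c' -> x <= y -> c * q `^ x <= c' * q `^ y.
Proof.
move=> q1 /andP[c0 cc'] xy.
by apply: ler_pM => //; [apply: powR_ge0|apply: ler_powR].
Qed.

(** The hypotheses provide one constant for each scale; boundedly many scales
    share a constant. *)
Lemma common_constant (R : realDomainType) (Q : nat -> R -> Prop) (J : nat) :
  (forall j c c', 0 < c' <= c -> Q j c -> Q j c') ->
  (forall j, exists c, 0 < c /\ Q j c) ->
  exists c, 0 < c /\ forall j, (j < J)%N -> Q j c.
Proof.
move=> anti ex; elim: J => [|J [c [c0 IH]]]; first by exists 1.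
have [d [d0 Qd]] := ex J; exists (Num.min c d); split.
  by rewrite lt_min c0.
move=> j; rewrite ltnS leq_eqVlt => /predU1P[->|jJ].
  by apply: anti Qd; rewrite lt_min c0 d0 /= ge_min lexx orbT.
by apply: anti (IH _ jJ); rewrite lt_min c0 d0 /= ge_min lexx.
Qed.

Lemma scale_of (R : realType) (q x dl : R) (J : nat) :
  1 <= q -> 1 <= x < q `^ (J%:R * dl) ->
  exists2 j, (j < J)%N & q `^ (j%:R * dl) <= x < q `^ (j.+1%:R * dl).
Proof.
move=> q1; elim: J => [|J IH] /andP[x1 xJ].
  by move: xJ; rewrite mul0r powRr0 ltNge x1.
have [le|lt] := leP (q `^ (J%:R * dl)) x; first by exists J => //; apply/andP.
by case: IH => [|j jJ h]; [apply/andP|exists j => //; apply: ltnW].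
Qed.

Lemma pow_le_inv (R : realType) (q x y : R) :
  2 <= q -> q `^ x <= q `^ y -> x <= y.
Proof.
move=> q2; have q0 : 0 < q by lra.
move=> h; rewrite -ler_ln ?posrE ?powR_gt0 // !ln_powR in h.
by move: h; rewrite ler_pM2r //; apply: ln_gt0; lra.
Qed.

Lemma min_cases (R : realType) (x y : R) :
  (Num.min x y = x /\ x <= y) \/ (Num.min x y = y /\ y <= x).
Proof. by case: (leP x y) => h; [left|right; split=> //; apply: ltW]. Qed.

(** * Furstenberg bounds *)

Definition rich_family (R : realType) (p n k : nat) (mu : R)
    (E : {set 'rV['F_p]_n}) (VV : {set {set 'rV['F_p]_n}}) : Prop :=
  forall V, V \in VV -> aplane k V /\ mu <= #|E :&: V|%:R.

(** The property to be proved, for families of planes that meet E in enough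
    points, with separate constants a and b for the richness and the number of
    planes: this form is stable under all the reductions below. *)
Definition furstenberg_bound (R : realType) (n k : nat) (s t f : R) : Prop :=
  forall a b eps : R, 0 < a -> 0 < b -> 0 < eps ->
  exists c : R, 0 < c /\
    forall p, prime p ->
    forall (E : {set 'rV['F_p]_n}) (VV : {set {set 'rV['F_p]_n}}),
      rich_family k (a * p%:R `^ s) E VV -> b * p%:R `^ t <= #|VV|%:R ->
      c * p%:R `^ (f - eps) <= #|E|%:R.

Lemma prime_ge2 (R : realType) p : prime p -> 2 <= p%:R :> R.
Proof. by move=> /prime_gt1; rewrite ler_nat. Qed.

Lemma rich_nonempty (R : realType) (n k p : nat) (a b s t : R)
    (E : {set 'rV['F_p]_n}) VV : 0 < a -> 0 < b -> prime p ->
  rich_family k (a * p%:R `^ s) E VV -> b * p%:R `^ t <= #|VV|%:R ->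
  exists2 V, V \in VV & a * p%:R `^ s <= #|E|%:R.
Proof.
move=> a0 b0 pp rE cV; have q2 := prime_ge2 R pp.
have : 0 < #|VV|%:R :> R.
  by apply: lt_le_trans cV; rewrite mulr_gt0 ?powR_gt0 //; lra.
rewrite ltr0n card_gt0 => /set0Pn[V VV0]; exists V => //.
have [_ h] := rE _ VV0; apply: le_trans h _.
by rewrite ler_nat subset_leq_card ?subsetIl.
Qed.

(** It suffices to treat large p and, for t >= 0, families VV of size
    comparable to p^t. Small primes only cost a constant because E is
    nonempty, and a larger family can be truncated. *)
Lemma furstenberg_bound_large (R : realType) (n k : nat) (s t f : R) :
  (forall a b eps : R, 0 < a -> 0 < b -> 0 < eps ->
   exists c : R, 0 < c /\ exists P : R,
     forall p, prime p -> P <= p%:R ->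
     forall (E : {set 'rV['F_p]_n}) (VV : {set {set 'rV['F_p]_n}}),
      rich_family k (a * p%:R `^ s) E VV -> b * p%:R `^ t <= #|VV|%:R ->
      (0 <= t -> #|VV|%:R <= (b + 1) * p%:R `^ t) ->
      c * p%:R `^ (f - eps) <= #|E|%:R) ->
  furstenberg_bound n k s t f.
Proof.
move=> H a b eps a0 b0 e0; have [c [c0 [P HP]]] := H a b eps a0 b0 e0.
pose Q : R := Num.max 1 P; have Q1 : 1 <= Q by rewrite le_max lexx.
(* For p < Q the left-hand side is at most 1, hence at most #|E|. *)
pose c1 := (Q `^ `|f - eps|)^-1.
have c10 : 0 < c1 by rewrite invr_gt0 powR_gt0 //; lra.
exists (Num.min c c1); split; first by rewrite lt_min c0.
move=> p pp E VV rE cV; have q2 := prime_ge2 R pp.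
have [Pq|Pq] := leP P p%:R.
  apply: le_trans (_ : c * p%:R `^ (f - eps) <= _).
    apply: pow_le => //; first by lra.
    by rewrite le_min ge_min lexx (ltW c0) (ltW c10).
  have [t0|t0] := leP 0 t; last first.
    by apply: HP pp Pq _ _ rE cV _; rewrite leNgt t0.
  pose m := `|Num.ceil (b * p%:R `^ t)|%N.
  have x0 : 0 <= b * p%:R `^ t by rewrite mulr_ge0 ?powR_ge0 ?ltW.
  have mE : m%:R = (Num.ceil (b * p%:R `^ t))%:~R :> R.
    by rewrite /m natr_absz ger0_norm // ceil_ge0; lra.
  have mle : (m <= #|VV|)%N.
    rewrite -(ler_nat R) mE -[#|VV|%:R]/(#|VV|%:Z%:~R) ler_int.
    by rewrite real_ceil_le_int ?num_real.
  have [WW sub cW] := subset_of_card mle.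
  apply: (HP p pp Pq E WW).
  - by move=> V /(subsetP sub); apply: rE.
  - by rewrite cW mE; have /andP[] := real_ceil_itv (num_real (b * p%:R `^ t)).
  - move=> _; rewrite cW mE mulrDl mul1r.
    have : 1 <= p%:R `^ t.
      have q1 : 1 <= p%:R :> R by lra.
      by have := ler_powR q1 t0; rewrite powRr0.
    have /andP[+ _] := real_ceil_itv (num_real (b * p%:R `^ t)); rewrite intrB; lra.
have [V _ h] := rich_nonempty a0 b0 pp rE cV.
have E1 : 1 <= #|E|%:R :> R.
  rewrite ler1n -(ltr0n R); apply: lt_le_trans h.
  by rewrite mulr_gt0 ?powR_gt0 //; lra.
apply: le_trans E1; apply: le_trans (_ : c1 * Q `^ `|f - eps| <= _).
  apply: ler_pM; rewrite ?powR_ge0 //.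
  - by rewrite le_min (ltW c0) (ltW c10).
  - by rewrite ge_min lexx orbT.
  apply: le_trans (_ : p%:R `^ `|f - eps| <= _).
    by apply: ler_powR; [lra|apply: ler_norm].
  apply: (ge0_ler_powR (normr_ge0 _)); rewrite ?nnegrE; [lra|lra|].
  by rewrite le_max (ltW Pq) orbT.
by rewrite mulVf // gt_eqF // powR_gt0; lra.
Qed.

Lemma furstenberg_bound_le (R : realType) (n k : nat) (s t f s' t' f' : R) :
  furstenberg_bound n k s t f -> s <= s' -> t <= t' -> f' <= f ->
  furstenberg_bound n k s' t' f'.
Proof.
move=> H ss tt ff a b eps a0 b0 e0; have [c [c0 Hc]] := H a b eps a0 b0 e0.
exists c; split=> // p pp E VV rE cV; have q2 := prime_ge2 R pp.
have q1 : 1 <= p%:R :> R by lra.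
apply: le_trans (_ : c * p%:R `^ (f - eps) <= _).
  by apply: pow_le; rewrite ?lexx ?andbT; lra.
apply: (Hc p pp E VV).
  move=> V /rE[pV h]; split=> //; apply: le_trans h.
  by apply: pow_le; rewrite ?lexx ?andbT; lra.
by apply: le_trans cV; apply: pow_le; rewrite ?lexx ?andbT; lra.
Qed.

Lemma furstenberg_bound_trivial (R : realType) (n k : nat) (s t : R) :
  furstenberg_bound n k s t s.
Proof.
move=> a b eps a0 b0 e0; exists a; split=> // p pp E VV rE cV.
have q2 := prime_ge2 R pp.
have [V _ h] := rich_nonempty a0 b0 pp rE cV; apply: le_trans h.
by apply: pow_le; rewrite ?lexx ?andbT; lra.
Qed.

(** A rich plane of dimension 0 is a point of E. *)
Lemma furstenberg_bound_points (R : realType) (n : nat) (s t : R) :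
  furstenberg_bound n 0 s t t.
Proof.
move=> a b eps a0 b0 e0; exists b; split=> // p pp E VV rE cV.
have q2 := prime_ge2 R pp.
apply: le_trans (_ : #|VV|%:R <= _).
  apply: le_trans cV.
  by apply: pow_le; rewrite ?lexx ?andbT; lra.
rewrite ler_nat -(card_imset (mem E) (@set1_inj _)); apply: subset_leq_card.
apply/subsetP => V /rE[[_ _ /eqP/cards1P[x ->]] h].
apply: imset_f; move: h; apply: contraTT => xE.
rewrite -ltNge (_ : _ :&: _ = set0) ?cards0 ?mulr_gt0 ?powR_gt0 //; first lra.
by apply/setP => y; rewrite !inE; case: eqP => [->|]; rewrite ?(negbTE xE) ?andbF.
Qed.

(** * Projecting along a direction *)

(** The pairs of distinct points of B identified by a projection along u. *)
Definition collisions_along (F : finFieldType) (n : nat) (B : {set 'rV[F]_n}) u :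
    {set 'rV[F]_n * 'rV[F]_n} :=
  [set xy in setX B B |
    (xy.1 != xy.2) && [exists c, xy.1 - xy.2 == c *: u]].

Lemma collisions_image (F : finFieldType) (n m : nat) (A : 'M[F]_(n, m)) u B :
  projects_along A u ->
  collisions (fun x => x *m A) B = collisions_along B u.
Proof.
move=> pA; apply/setP => -[x y]; rewrite !inE /=; congr (_ && (_ && _)).
apply/eqP/existsP => [/(projects_eq _ _ pA)[c ->]|[c /eqP e]].
  by exists c; rewrite addrC addKr.
by apply/(projects_eq _ _ pA); exists c; rewrite -e addrC subrK.
Qed.

Lemma image_large (R : realType) (F : finFieldType) (n m : nat)
    (A : 'M[F]_(n, m)) u (B : {set 'rV[F]_n}) (a C Q K : R) :
  projects_along A u -> 0 < a -> 0 <= C -> 0 < Q <= K -> a * Q <= #|B|%:R ->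
  #|collisions_along B u|%:R <= C * #|B|%:R ^+ 2 / K ->
  a / (1 + C * a) * Q <= #|mximage A B|%:R.
Proof.
move=> pA a0 C0 QK aB cB; apply: few_collisions_large_image QK aB cB _ _ => //.
by rewrite -(collisions_image B pA); apply: card_imset_collisions.
Qed.

Lemma card_directions (F : finFieldType) (n : nat) (w : 'rV[F]_n) (I : {set 'rV[F]_n}) :
  w != 0 -> 0 \notin I ->
  (#|[set u in I | [exists c, w == c *: u]]| <= #|F|.-1)%N.
Proof.
move=> w0 I0.
have -> : #|F|.-1 = #|[set c : F | c != 0]|.
  by rewrite cardsE -(cardC1 (0 : F)); apply: eq_card => c; rewrite !inE.
apply: leq_trans (leq_imset_card (fun c => c^-1 *: w) _); apply: subset_leq_card.
apply/subsetP => u; rewrite inE => /andP[uI /existsP[c /eqP e]].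
have c0 : c != 0 by apply: contraNneq w0 => c0; rewrite e c0 scale0r.
apply/imsetP; exists c; rewrite ?inE //.
by rewrite e scalerA mulVf // scale1r.
Qed.

Lemma card_nonzero_dirs (F : finFieldType) (n k : nat) (V : {set 'rV[F]_n}) :
  aplane k V -> #|dirs V :\ 0|.+1 = (#|F| ^ k)%N.
Proof.
by move=> [V0 fV cV]; rewrite -cV -(card_dirs V0 fV) [RHS](cardsD1 0) dirs0.
Qed.

(** Summed over the nonzero directions of V, the coincidences number at most
    #|B|^2 (p-1), so Markov's inequality leaves most directions with at most
    about four times the average. *)
Lemma many_good_directions (R : realType) (p n k : nat)
    (V B : {set 'rV['F_p]_n}) : prime p ->
  aplane k.+1 V -> B != set0 ->
  p%:R ^+ k.+1 / 4 <= #|[set u in dirs V :\ 0 |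
    #|collisions_along B u|%:R <= 4 * #|B|%:R ^+ 2 / p%:R ^+ k :> R]|%:R :> R.
Proof.
move=> pp pV B0; have q2 := prime_ge2 R pp.
set q : R := p%:R in q2 *; set m : R := #|B|%:R.
have m0 : 0 < m by rewrite ltr0n card_gt0.
set I := dirs V :\ 0; set G := [set u in I | _].
pose x u : R := #|collisions_along B u|%:R.
have cI : #|I|%:R + 1 = q ^+ k.+1.
  by rewrite natr1 (card_nonzero_dirs pV) card_Fp // natrX.
have sumx : \sum_(u in I) x u <= m ^+ 2 * (q - 1).
  rewrite -natr_sum.
  rewrite (double_count I (setX B B)
    (fun u xy => (xy.1 != xy.2) && [exists c, xy.1 - xy.2 == c *: u])).
  apply: le_trans (_ : (\sum_(xy in setX B B) p.-1)%:R <= _).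
    rewrite ler_nat; apply: leq_sum => -[y z] _ /=.
    have [_|yz] := eqVneq y z.
      by rewrite eq_card0 // => u; rewrite !inE /= andbF.
    rewrite -[X in X.-1](card_Fp pp) /=; apply: card_directions.
      by rewrite subr_eq0.
    by rewrite !inE eqxx.
  rewrite sum_nat_const cardsX !natrM -subn1 natrB ?prime_gt0 //.
pose th : R := 4 * m ^+ 2 / q ^+ k.
have q0 : 0 < q by lra.
have qk0 : 0 < q ^+ k by apply: exprn_gt0.
have qk1 : 1 <= q ^+ k by apply: exprn_ege1; lra.
have mk := @markov_card R _ I x th (fun i _ => ler0n R _).
set Bd := [set i in I | th <= x i] in mk.
have hB : #|Bd|%:R * 4 <= q ^+ k * (q - 1).
  have := le_trans mk sumx; rewrite /th.
  rewrite (_ : _ * (4 * m ^+ 2 / q ^+ k) = m ^+ 2 * (#|Bd|%:R * 4 / q ^+ k)).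
    rewrite ler_pM2l ?exprn_gt0 // ler_pdivrMr // => h; lra.
  by ring.
have hI : #|I|%:R <= #|Bd|%:R + #|G|%:R :> R.
  rewrite -natrD ler_nat.
  apply: leq_trans (_ : #|Bd :|: G| <= _)%N; last first.
    by rewrite cardsU leq_subr.
  apply: subset_leq_card; apply/subsetP => u uI.
  rewrite inE [u \in Bd]inE [u \in G]inE uI /=.
  by rewrite -/(x u) -/th; case: leP => //= /ltW.
have : q ^+ k.+1 = q * q ^+ k by rewrite exprS.
have : 2 * q ^+ k <= q * q ^+ k by rewrite ler_pM2r.
move=> h1 h2; rewrite h2 in cI *; nra.
Qed.

(** Averaging over u the number of planes for which u is a good direction
    produces a u shared by a fraction of about p^(k-n) of them. *)
Lemma furstenberg_bound_project (R : realType) (n k : nat) (s t f : R) :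
  s <= k%:R -> furstenberg_bound n k s (t - (n%:R - k%:R)) f ->
  furstenberg_bound n.+1 k.+1 s t f.
Proof.
move=> sk H a b eps a0 b0 e0.
have a'0 : 0 < a / (1 + 4 * a) by apply: divr_gt0 => //; lra.
have b'0 : 0 < b / 4 by lra.
have [c [c0 Hc]] := H _ _ _ a'0 b'0 e0.
exists c; split=> // p pp E VV rE cV; have q2 := prime_ge2 R pp.
set q : R := p%:R in q2 rE cV *; have q0 : 0 < q by lra.
pose good V u := (u \in dirs V :\ 0) && (#|collisions_along (E :&: V) u|%:R <=
   4 * #|E :&: V|%:R ^+ 2 / q ^+ k).
have EV0 V : V \in VV -> E :&: V != set0.
  move=> /rE[_ h]; rewrite -card_gt0 -(ltr0n R); apply: lt_le_trans h.
  by rewrite mulr_gt0 ?powR_gt0.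
have : exists2 u, u \in [set: 'rV['F_p]_n.+1] &
    b / 4 * q `^ (t - (n%:R - k%:R)) <= #|[set V in VV | good V u]|%:R.
  apply: average_ge; first by apply/set0Pn; exists 0; rewrite inE.
  rewrite -natr_sum double_count natr_sum.
  apply: le_trans (_ : \sum_(V in VV) q ^+ k.+1 / 4 <= _); last first.
    apply: ler_sum => V VVV; have [pV _] := rE _ VVV.
    apply: le_trans (many_good_directions R pp pV (EV0 _ VVV)) _.
    by rewrite ler_nat subset_leq_card //; apply/subsetP => u; rewrite /good !inE.
  rewrite sumr_const -[X in _ <= X]mulr_natl cardsT card_row card_Fp // natrX -/q.
  apply: le_trans (_ : b * q `^ t * (q ^+ k.+1 / 4) <= _); last first.
    by rewrite ler_wpM2r // divr_ge0 // exprn_ge0 // (ltW q0).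
  rewrite -!powR_mulrn ?(ltW q0) // -![k.+1%:R]natr1 -![n.+1%:R]natr1.
  rewrite (_ : q `^ (n%:R + 1) * (b / 4 * q `^ (t - (n%:R - k%:R))) =
    b / 4 * (q `^ (n%:R + 1) * q `^ (t - (n%:R - k%:R)))); last by ring.
  rewrite (_ : b * q `^ t * (q `^ (k%:R + 1) / 4) =
    b / 4 * (q `^ t * q `^ (k%:R + 1))); last by field.
  rewrite -!powD // (_ : n%:R + 1 + _ = t + (k%:R + 1)) //; ring.
case=> u _ hu.
have : [set V in VV | good V u] != set0.
  rewrite -card_gt0 -(ltr0n R); apply: lt_le_trans hu.
  by rewrite mulr_gt0 ?powR_gt0 ?divr_gt0.
case/set0Pn => V0; rewrite inE => /andP[_ /andP[]]; rewrite in_setD1 => /andP[u0 _] _.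
have [A pA] := exists_projection u0.
apply: le_trans (_ : #|mximage A E|%:R <= _); last first.
  by rewrite ler_nat; apply: leq_imset_card.
apply: (Hc p pp _ [set mximage A V | V in [set V in VV | good V u]]).
  move=> _ /imsetP[V + ->]; rewrite inE => /andP[VVV /andP[+ gV]].
  rewrite in_setD1 => /andP[_ uV]; have [pV mV] := rE _ VVV.
  split; first exact: aplane_image_proj pA u0 pV uV.
  apply: le_trans (_ : #|mximage A (E :&: V)|%:R <= _); last first.
    rewrite ler_nat subset_leq_card //; apply/subsetP => x /imsetP[y].
    by case/setIP => yE yV ->; rewrite inE; apply/andP; split; apply: imset_f.
  apply: (image_large pA) gV => //; rewrite ?powR_gt0 //=.
  by rewrite -powR_mulrn ?(ltW q0) // ler_powR //; lra.
rewrite card_in_imset // => V V'; rewrite !inE.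
move=> /andP[VVV /andP[]] + _ /andP[VVV' /andP[]] + _ e.
rewrite !in_setD1 => /andP[_ uV] /andP[_ uV'].
have [[V1 fV _] _] := rE _ VVV; have [[V1' fV' _] _] := rE _ VVV'.
apply/eqP; rewrite eqEsubset.
rewrite (image_proj_inj pA V1' fV' uV') ?e //.
by rewrite (image_proj_inj pA V1 fV uV) ?e.
Qed.

(** * Second moment of hyperplane sections *)

(** A bound valid in F^r applies inside every r-flat of F^n, since an r-flat
    is linearly isomorphic to F^r. *)
Lemma bound_inside (R : realType) (r n k p : nat) (mu nu lb : R) :
  (forall (E : {set 'rV['F_p]_r}) VV,
     rich_family k mu E VV -> nu <= #|VV|%:R -> lb <= #|E|%:R) ->
  forall (S E : {set 'rV['F_p]_n}) VV, aplane r S ->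
    rich_family k mu E VV -> (forall V, V \in VV -> V \subset S) ->
    nu <= #|VV|%:R -> lb <= #|E :&: S|%:R.
Proof.
move=> H S E VV pS rE VS cV; have [A iA] := aplane_coords pS.
have -> : #|E :&: S| = #|mximage A (E :&: S)|.
  by rewrite card_in_imset // => x y /setIP[_ xS] /setIP[_ yS]; exact: iA.
apply: (H _ [set mximage A V | V in VV]).
  move=> _ /imsetP[V VVV ->]; have [pV mV] := rE _ VVV.
  have /subsetP VS' := VS _ VVV.
  split.
    by apply: aplane_image_inj pV _ => x y xV yV; apply: iA; apply: VS'.
  apply: le_trans mV _; rewrite ler_nat.
  rewrite -(@card_in_imset _ _ (fun x => x *m A)); last first.
    by move=> x y /setIP[_ xV] /setIP[_ yV]; apply: iA; apply: VS'.
  apply: subset_leq_card; apply/subsetP => _ /imsetP[x /setIP[xE xV] ->].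
  rewrite inE; apply/andP; split; apply: imset_f => //.
  by rewrite inE xE VS'.
rewrite card_in_imset // => V V' VVV VVV' e.
have sub W W' : W \in VV -> W' \in VV -> mximage A W = mximage A W' -> W \subset W'.
  move=> WV WV' eW; apply/subsetP => x xW.
  have : x *m A \in mximage A W' by rewrite -eW; apply: imset_f.
  case/imsetP => y yW' /iA ->//; apply: subsetP; try eassumption; exact: VS.
by apply/eqP; rewrite eqEsubset !sub.
Qed.

Lemma aplane_setT (F : finFieldType) (n : nat) : aplane n [set: 'rV[F]_n].
Proof.
split; last by rewrite cardsT card_row.
  by apply/set0Pn; exists 0; rewrite inE.
by move=> *; rewrite inE.
Qed.

Lemma aplane_hyperplane (F : finFieldType) (n : nat) (h : 'cV[F]_n.+1 * F) :
  h.1 != 0 -> aplane n (hyperplane h).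
Proof.
move=> h0; rewrite -[hyperplane h]setTI.
have [i hi] := col_neq0 h0.
apply: (aplane_section (aplane_setT F n.+1)) (_ : delta_mx 0 i \in _) _.
  by rewrite inE; apply/forall_inP => x _; rewrite inE.
by rewrite -rowE; apply: contraNneq hi => /rowP/(_ 0); rewrite !mxE => ->.
Qed.

Lemma sum_card_section (R : realType) (p n : nat) (E : {set 'rV['F_p]_n}) :
  prime p -> \sum_(h in [set: 'cV['F_p]_n * 'F_p]) #|E :&: hyperplane h|%:R =
             #|E|%:R * p%:R ^+ n :> R.
Proof.
move=> pp; rewrite -natr_sum -natrX -natrM -sum_nat_const; congr _%:R.
have <- : (\sum_(x in E) #|[set h in [set: 'cV['F_p]_n * 'F_p] | x \in hyperplane h]| =
           \sum_(x in E) p ^ n)%N.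
  apply: eq_bigr => x _; rewrite -[X in (X ^ _)%N](card_Fp pp).
  rewrite -(card_hyperplanes_point x); apply: eq_card => h.
  by rewrite !inE.
rewrite double_count; apply: eq_bigr => h _; apply: eq_card => x.
by rewrite !inE.
Qed.

(** The incidences of two distinct points with a random hyperplane are
    uncorrelated, so the variance of #|E :&: H| is at most its mean. Summed
    over all p^(n+1) equations this is the stated bound. *)
Lemma section_variance (R : realType) (p n : nat) (E : {set 'rV['F_p]_n}) :
  prime p ->
  \sum_(h in [set: 'cV['F_p]_n * 'F_p])
     (#|E :&: hyperplane h|%:R - #|E|%:R / p%:R) ^+ 2 <= #|E|%:R * p%:R ^+ n :> R.
Proof.
move=> pp; have q2 := prime_ge2 R pp.
pose HH := [set: 'cV['F_p]_n * 'F_p].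
set q : R := p%:R in q2 *; set e : R := #|E|%:R.
have q0 : 0 < q by lra.
have e0 : 0 <= e by rewrite ler0n.
pose x h : R := #|E :&: hyperplane h|%:R.
have cH : #|HH|%:R = q ^+ n.+1.
  by rewrite cardsT card_prod card_col card_Fp // -expnSr natrX.
have sx2 : \sum_(h in HH) x h ^+ 2 * q <= e * q ^+ n * q + e * e * q ^+ n.
  rewrite -mulr_suml.
  under eq_bigr do rewrite /x -natrX -mulnn -cardsX.
  rewrite -natr_sum.
  have -> : (\sum_(h in HH) #|setX (E :&: hyperplane h) (E :&: hyperplane h)| =
    \sum_(xy in setX E E) #|[set h in HH | (xy.1 \in hyperplane h) && (xy.2 \in hyperplane h)]|)%N.
    rewrite [RHS]double_count; apply: eq_bigr => h _; apply: eq_card => -[y z].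
    rewrite [RHS]inE !in_setX !in_setI /=.
    by case: (y \in E); case: (z \in E); rewrite ?andbF.
  rewrite (bigID (fun xy => xy.1 == xy.2)) /= natrD mulrDl; apply: lerD.
    rewrite ler_pM2r //.
    rewrite (eq_bigr (fun _ => p ^ n)%N); last first.
      move=> -[y z] /= /andP[_ /eqP <-]; rewrite -[X in (X ^ _)%N](card_Fp pp).
      by rewrite -(card_hyperplanes_point y); apply: eq_card => h; rewrite !inE andbb.
    rewrite sum_nat_cond_const natrM natrX ler_pM2r ?exprn_gt0 // ler_nat.
    rewrite -(@card_imset _ _ (fun x => (x, x)) E); last by move=> u v [].
    apply: subset_leq_card; apply/subsetP => -[y z].
    by rewrite inE in_setX /= => /andP[/andP[yE _] /eqP <-]; apply: imset_f.
  rewrite -natrM big_distrl /=.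
  apply: le_trans (_ : (\sum_(xy in setX E E) p ^ n)%:R <= _); last first.
    by rewrite sum_nat_const cardsX !natrM natrX.
  rewrite ler_nat [X in (_ <= X)%N](bigID (fun xy => xy.1 == xy.2)) /=.
  apply: leq_trans (leq_addl _ _); apply: leq_sum => -[y z] /= /andP[_ yz].
  rewrite -[X in (_ * X)%N](card_Fp pp) -[X in (X ^ _)%N](card_Fp pp).
  rewrite -(card_hyperplanes_pair yz) leq_mul2r; apply/orP; right.
  by apply: subset_leq_card; apply/subsetP => h; rewrite !inE.
have sx : \sum_(h in HH) x h = e * q ^+ n := sum_card_section R E pp.
have -> : \sum_(h in HH) (x h - e / q) ^+ 2 =
   \sum_(h in HH) x h ^+ 2 - e * e * q ^+ n / q.
  under eq_bigr do rewrite sqrrB.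
  rewrite big_split sumrB /= sumr_const sumrMnl -mulr_suml sx.
  rewrite -[X in _ + X]mulr_natl cH exprS; field; exact: lt0r_neq0.
rewrite lerBlDr -(ler_pM2r q0) mulr_suml.
by apply: le_trans sx2 _; rewrite mulrDl divfK ?gt_eqF.
Qed.

(** * Slicing by a hyperplane *)

(** The hyperplane cuts V properly and captures at least half of the expected
    share of the points of E on V. *)
Definition good_section (F : finFieldType) (n : nat) (E V : {set 'rV[F]_n}) h :=
  ~~ (V \subset hyperplane h) &&
  (#|E :&: V| <= 2 * #|F| * #|E :&: V :&: hyperplane h|)%N.

(** The section is nonempty because E has points on it, and proper because V
    is not contained in the hyperplane. *)
Lemma good_section_aplane (F : finFieldType) (n k : nat) (E V : {set 'rV[F]_n}) h :
  aplane k.+1 V -> E :&: V != set0 -> good_section E V h ->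
  aplane k (V :&: hyperplane h).
Proof.
move=> pV E0 /andP[/subsetPn[y yV yh] big]; have [_ fV _] := pV.
have : E :&: V :&: hyperplane h != set0.
  rewrite -card_gt0; move: E0; rewrite -card_gt0; apply: contraTT.
  by rewrite -!leqNgt !leqn0 => /eqP c0; move: big; rewrite c0 muln0 leqn0.
case/set0Pn => x /setIP[/setIP[_ xV] xh].
apply: (aplane_section pV) (dirsB fV xV yV) _.
apply: contraNneq yh => /matrixP/(_ 0 0); move: xh; rewrite !inE mulmxBl.
by rewrite !mxE => /eqP <- /eqP; rewrite subr_eq0.
Qed.

(** Two exceptional sets are removed. Hyperplanes containing V are rare by
    counting; hyperplanes that miss half of the expected share of E on V are
    rare by [section_variance] and Chebyshev's inequality. *)
Lemma many_good_sections (R : realType) (p n k : nat) (E V : {set 'rV['F_p]_n.+1}) :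
  prime p -> (1 <= k)%N -> aplane k.+1 V -> 16 * p%:R <= #|E :&: V|%:R :> R ->
  p%:R ^+ n.+2 / 2 <= #|[set h | good_section E V h]|%:R :> R.
Proof.
move=> pp k1 pV big; have q2 := prime_ge2 R pp.
set B := E :&: V in big *; set G := [set h | _].
pose HH := [set: 'cV['F_p]_n.+1 * 'F_p].
set q : R := p%:R in q2 big *; set m : R := #|B|%:R in big *.
have q0 : 0 < q by lra.
have m0 : 0 < m by lra.
pose Bd1 := [set h in HH | V \subset hyperplane h].
pose x h : R := (#|B :&: hyperplane h|%:R - m / q) ^+ 2.
pose th : R := (m / (2 * q)) ^+ 2.
pose Bd2 := [set h in HH | th <= x h].
have th0 : 0 < th by rewrite exprn_gt0 // divr_gt0 //; lra.
have qn0 : 0 < q ^+ n.+2 by apply: exprn_gt0.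
have c2 : #|Bd2|%:R <= q ^+ n.+2 / 4.
  have mk := @markov_card R _ HH x th (fun i _ => sqr_ge0 _).
  have := le_trans mk (section_variance R B pp).
  rewrite -/q -/m -/Bd2 => le.
  rewrite -(ler_pM2r th0); apply: le_trans le _.
  rewrite /th (_ : q ^+ n.+2 / 4 * (m / (2 * q)) ^+ 2 = m * q ^+ n.+1 * (m / (16 * q))).
    by rewrite ler_peMr ?mulr_ge0 ?(ltW m0) ?exprn_ge0 ?(ltW q0) // ler_pdivlMr ?mul1r //; lra.
  by rewrite exprS; field; rewrite gt_eqF.
have c1 : #|Bd1|%:R <= q ^+ n.+2 / 4.
  have : (#|Bd1| * p ^ k.+1 = p ^ n.+1)%N.
    have := card_hyperplanes_through pV; rewrite !(card_Fp pp) => <-.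
    by congr (_ * _)%N; apply: eq_card => h; rewrite !inE.
  move=> /(congr1 (fun i : nat => i%:R : R)); rewrite natrM !natrX -/q => e.
  have q1 : 1 <= q by lra.
  have h1 : q ^+ 2 <= q ^+ k.+1 by rewrite ler_eXn2l // -?ltnS; lra.
  have h2 : #|Bd1|%:R * q ^+ 2 <= q ^+ n.+1.
    by rewrite -e ler_wpM2l ?ler0n.
  have h3 : 2 * q ^+ n.+1 <= q ^+ n.+2 by rewrite [leRHS]exprS ler_pM2r ?exprn_gt0.
  have h4 : 4 <= q ^+ 2 by rewrite expr2; nra.
  have h5 : 0 <= #|Bd1|%:R :> R by [].
  nra.
have cHH : #|HH|%:R = q ^+ n.+2.
  by rewrite cardsT card_prod card_col card_Fp // -expnSr natrX.
have : #|HH|%:R <= #|Bd1|%:R + #|Bd2|%:R + #|G|%:R :> R.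
  rewrite -!natrD ler_nat.
  apply: leq_trans (_ : #|Bd1 :|: Bd2 :|: G| <= _)%N; last first.
    by rewrite (leq_trans (leq_card_setU _ _).1) // leq_add2r (leq_card_setU _ _).1.
  apply: subset_leq_card; apply/subsetP => h _.
  rewrite !in_setU !in_set /= /good_section; case: (V \subset _) => //=.
  apply/orP; have [|lt] := leP th (x h); [by left|right].
  rewrite -(ler_nat R) !natrM -/B -/m card_Fp // -/q.
  set y : R := #|B :&: hyperplane h|%:R.
  have lt' : - (m / (2 * q)) < y - m / q.
    have := lt; rewrite /x /th -/y -real_normK ?num_real //.
    rewrite ltr_pXn2r ?nnegrE ?normr_ge0 // ?divr_ge0 ?mulr_ge0 ?(ltW m0) ?(ltW q0) //.
    by rewrite ltr_norml => /andP[].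
  have e1 : m / q = 2 * (m / (2 * q)) by field; rewrite gt_eqF.
  have e2 : m = 2 * q * (m / (2 * q)) by field; rewrite gt_eqF.
  rewrite e2; rewrite ler_pM2l; lra.
rewrite cHH; lra.
Qed.

(** If the two sections coincide, they fill the whole intersection of V and
    V', which is then a k-flat contained in the hyperplane. *)
Lemma collapsing_sections (F : finFieldType) (n k : nat) (E V V' : {set 'rV[F]_n}) :
  aplane k.+1 V -> aplane k.+1 V' -> V != V' -> E :&: V != set0 -> 
  (#|[set h | [&& good_section E V h, good_section E V' h &
       V :&: hyperplane h == V' :&: hyperplane h]]| * #|F| ^ k <= #|F| ^ n)%N.
Proof.
move=> pV pV' neq E0; set S := [set h | _].
have [->|/set0Pn[h0]] := eqVneq S set0; first by rewrite cards0.
have sub h : h \in S -> aplane k (V :&: V') /\ V :&: V' \subset hyperplane h.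
  rewrite inE => /and3P[gV _ /eqP e].
  have pB := good_section_aplane pV E0 gV.
  suff <- : V :&: hyperplane h = V :&: V' by split=> //; apply: subsetIr.
  apply/eqP; rewrite eqEcard subsetI subsetIl /= {1}e subsetIl /=.
  by case: pB => _ _ ->; apply: card_aplane_cap.
move=> /sub[pB _]; rewrite -(card_hyperplanes_through pB) leq_mul2r.
apply/orP; right; apply: subset_leq_card; apply/subsetP => h /sub[_].
by rewrite inE.
Qed.

(** Three averages have to be controlled by a single hyperplane: the number of
    good sections from below, the points of E and the coincidences of sections
    from above. One averages the first minus suitable multiples of the other
    two. *)
Lemma exists_good_hyperplane (R : realType) (p n k : nat) (N e : R)
    (E : {set 'rV['F_p]_n.+1}) (VV : {set {set 'rV['F_p]_n.+1}}) :
  prime p -> (1 <= k)%N -> N = #|VV|%:R -> e = #|E|%:R -> 0 < N -> 0 < e ->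
  (forall V, V \in VV -> aplane k.+1 V /\ 16 * p%:R <= #|E :&: V|%:R :> R) ->
  exists h, [/\ p%:R * #|E :&: hyperplane h|%:R <= 8 * e :> R,
    N / 8 <= #|[set V in VV | good_section E V h]|%:R &
    #|collisions (fun V : {set 'rV['F_p]_n.+1} => V :&: hyperplane h)
        [set V in VV | good_section E V h]|%:R
    <= 8 * N ^+ 2 / p%:R ^+ k.+1].
Proof.
move=> pp k1 NE eE N0 e0 rE; have q2 := prime_ge2 R pp.
pose HH := [set: 'cV['F_p]_n.+1 * 'F_p].
set q : R := p%:R in q2 rE *; have q0 : 0 < q by lra.
have B0 V : V \in VV -> E :&: V != set0.
  move=> /rE[_ h]; rewrite -card_gt0 -(ltr0n R); apply: lt_le_trans h; lra.
pose X h : R := #|[set V in VV | good_section E V h]|%:R.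
pose S h : R := #|E :&: hyperplane h|%:R.
pose C h : R := #|collisions (fun V : {set 'rV['F_p]_n.+1} => V :&: hyperplane h)
        [set V in VV | good_section E V h]|%:R.
have cHH : #|HH|%:R = q ^+ n.+2.
  by rewrite cardsT card_prod card_col card_Fp // -expnSr natrX.
have qn : 0 < q ^+ n.+2 by apply: exprn_gt0.
have qk : 0 < q ^+ k by apply: exprn_gt0.
have sX : N * (q ^+ n.+2 / 2) <= \sum_(h in HH) X h.
  rewrite -natr_sum double_count natr_sum NE mulr_natl -sumr_const.
  apply: ler_sum => V VVV; have [pV mV] := rE _ VVV.
  apply: le_trans (many_good_sections pp k1 pV mV) _.
  by rewrite ler_nat subset_leq_card //; apply/subsetP => h; rewrite !inE.
have sS : \sum_(h in HH) S h = e * q ^+ n.+1 by rewrite eE; apply: sum_card_section.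
have sC : (\sum_(h in HH) C h) * q ^+ k <= N ^+ 2 * q ^+ n.+1.
  pose P h (VW : {set 'rV['F_p]_n.+1} * {set 'rV['F_p]_n.+1}) :=
    [&& VW.1 != VW.2, good_section E VW.1 h, good_section E VW.2 h &
        VW.1 :&: hyperplane h == VW.2 :&: hyperplane h].
  have -> : \sum_(h in HH) C h =
      \sum_(h in HH) #|[set VW in setX VV VV | P h VW]|%:R.
    apply: eq_bigr => h _; congr _%:R; apply: eq_card => -[V W].
    rewrite [LHS]inE [RHS]inE !in_setX !inE /P /=.
    by case: (V \in VV); case: (W \in VV); case: (V != W); case: (good_section E V h);
       case: (good_section E W h); rewrite /= ?andbF.
  rewrite -natr_sum double_count natr_sum mulr_suml NE expr2 -natrM -cardsX.
  rewrite [leRHS]mulr_natl -sumr_const; apply: ler_sum => -[V W].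
  rewrite in_setX => /andP[VVV WVV].
  have [VW|VW] := eqVneq V W.
    rewrite (_ : [set _ in _ | _] = set0) ?cards0 ?mul0r ?exprn_ge0 ?(ltW q0) //.
    by apply/setP => h; rewrite !inE /P VW eqxx.
  have [pV _] := rE _ VVV; have [pW _] := rE _ WVV.
  have := collapsing_sections pV pW VW (B0 _ VVV); rewrite (card_Fp pp).
  rewrite -(ler_nat R) natrM !natrX -/q; apply: le_trans.
  rewrite ler_pM2r // ler_nat subset_leq_card //; apply/subsetP => h.
  by rewrite !inE /P /= => /and4P[_ -> -> ->].
have HH0 : HH != set0 by apply/set0Pn; exists (0, 0); rewrite inE.
(* The two subtracted terms have total mass at most N q^(n+2) / 8 each, against
   at least N q^(n+2) / 2 for X. *)
pose f h := X h - (N * q / (8 * e)) * S h - (q ^+ k.+1 / (8 * N)) * C h.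
have [h _ hf] : exists2 h, h \in HH & N / 8 <= f h.
  apply: average_ge HH0 _.
  rewrite /f !sumrB -!mulr_sumr sS cHH.
  have -> : N * q / (8 * e) * (e * q ^+ n.+1) = N * q ^+ n.+2 / 8.
    by rewrite [q ^+ n.+2]exprS; field; rewrite gt_eqF.
  have : q ^+ k.+1 / (8 * N) * (\sum_(h in HH) C h) <= N * q ^+ n.+2 / 8.
    have -> : q ^+ k.+1 / (8 * N) * (\sum_(h in HH) C h) =
              q / (8 * N) * ((\sum_(h in HH) C h) * q ^+ k).
      by rewrite exprS; field; rewrite gt_eqF.
    have -> : N * q ^+ n.+2 / 8 = q / (8 * N) * (N ^+ 2 * q ^+ n.+1).
      by rewrite [q ^+ n.+2]exprS; field; rewrite gt_eqF.
    by rewrite ler_pM2l // divr_gt0 // mulr_gt0.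
  move: sX; rewrite (_ : N * (q ^+ n.+2 / 2) = N * q ^+ n.+2 / 2); last by ring.
  rewrite (_ : q ^+ n.+2 * (N / 8) = N * q ^+ n.+2 / 8); last by ring.
  have : 0 < N * q ^+ n.+2 by apply: mulr_gt0.
  move: (N * q ^+ n.+2) (\sum_(h in HH) X h) (_ * \sum_(h in HH) C h) => u v w.
  lra.
have X_le : X h <= N.
  by rewrite NE ler_nat subset_leq_card //; apply/subsetP => V; rewrite inE => /andP[].
have t1 : 0 <= N * q / (8 * e) * S h.
  by rewrite mulr_ge0 ?ler0n // divr_ge0 ?mulr_ge0 ?(ltW N0) ?(ltW q0) ?(ltW e0).
have t2 : 0 <= q ^+ k.+1 / (8 * N) * C h.
  by rewrite mulr_ge0 ?ler0n // divr_ge0 ?mulr_ge0 ?exprn_ge0 ?(ltW N0) ?(ltW q0).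
rewrite /f in hf; exists h; split.
- have : N * q / (8 * e) * S h <= N by lra.
  rewrite (_ : N * q / (8 * e) * S h = N * (q * S h / (8 * e))); last by ring.
  by rewrite -{2}[N]mulr1 ler_pM2l // ler_pdivrMr ?mulr_gt0 // mul1r.
- rewrite -/(X h); lra.
- have : q ^+ k.+1 / (8 * N) * C h <= N by lra.
  rewrite -/(C h) ler_pdivlMr ?exprn_gt0 // => le.
  have : q ^+ k.+1 / (8 * N) * C h * (8 * N) <= N * (8 * N).
    by rewrite ler_pM2r ?mulr_gt0.
  rewrite (_ : q ^+ k.+1 / (8 * N) * C h * (8 * N) = C h * q ^+ k.+1).
    by rewrite expr2; lra.
  by field; rewrite gt_eqF.
Qed.

(** The section of E by a good hyperplane has about #|E| / p points, the
    planes become k-planes with about p^(s-1) points each, and since t <= k+1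
    there are few enough planes for most sections to be distinct. *)
Lemma furstenberg_bound_slice (R : realType) (n k : nat) (s t f : R) :
  (1 <= k)%N -> 1 < s -> t <= k%:R + 1 ->
  furstenberg_bound n k (s - 1) t (f - 1) -> furstenberg_bound n.+1 k.+1 s t f.
Proof.
move=> k1 s1 tk H; apply: furstenberg_bound_large => a b eps a0 b0 e0.
have a'0 : 0 < a / 2 by lra.
have b8 : 0 < b / 8 by lra.
(* 512 = 8 * 8^2: the coincidences are at most 8 N^2 / q^(k+1), where N is at
   most 8 times the number of good sections. *)
have b'0 : 0 < (b / 8) / (1 + 512 * (b / 8)) by apply: divr_gt0 => //; lra.
have [c [c0 Hc]] := H _ _ _ a'0 b'0 e0.
exists (c / 8); split; first by lra.
have s10 : 0 < s - 1 by lra.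
have [P HP] := pow_large (16 / a) s10; exists P.
move=> p pp /HP qs E VV rE cV _; have q2 := prime_ge2 R pp.
set q : R := p%:R in q2 qs rE cV *; have q0 : 0 < q by lra.
have qsE : q `^ s = q * q `^ (s - 1).
  by rewrite -{2}(powRr1 (ltW q0)) -powD // addrC subrK.
have N0 : 0 < #|VV|%:R :> R.
  by apply: lt_le_trans cV; rewrite mulr_gt0 ?powR_gt0.
have E0 : 0 < #|E|%:R :> R.
  have [V _ h] := rich_nonempty a0 b0 pp rE cV.
  by apply: lt_le_trans h; rewrite mulr_gt0 ?powR_gt0.
have rE' V : V \in VV -> aplane k.+1 V /\ 16 * q <= #|E :&: V|%:R :> R.
  move=> /rE[pV h]; split=> //; apply: le_trans h.
  rewrite qsE mulrCA mulrC ler_pM2l // mulrC -ler_pdivrMr //.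
have [h [hS hX hC]] := exists_good_hyperplane pp k1 erefl erefl N0 E0 rE'.
set G := [set V in VV | _] in hX hC.
have G0 V : V \in G -> aplane k (V :&: hyperplane h) /\
    a / 2 * q `^ (s - 1) <= #|E :&: (V :&: hyperplane h)|%:R.
  rewrite inE => /andP[VVV gV]; have [pV mV] := rE _ VVV.
  have B0 : E :&: V != set0.
    rewrite -card_gt0 -(ltr0n R); apply: lt_le_trans mV.
    by rewrite mulr_gt0 ?powR_gt0.
  split; first exact: good_section_aplane pV B0 gV.
  case/andP: gV => _; rewrite -(ler_nat R) !natrM card_Fp // setIA -/q => le.
  have := le_trans mV le; rewrite qsE.
  rewrite (_ : a * (q * q `^ (s - 1)) = 2 * q * (a / 2 * q `^ (s - 1))).
    by rewrite ler_pM2l // mulr_gt0.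
  by field.
have hneq : h.1 != 0.
  have : G != set0.
    by rewrite -card_gt0 -(ltr0n R); apply: lt_le_trans hX; rewrite divr_gt0.
  case/set0Pn => V VG; have [[/set0Pn[x /setIP[_ xh]] _ _] _] := G0 _ VG.
  move: VG; rewrite inE => /andP[_ /andP[nV _]].
  apply: contraNneq nV => h0; apply/subsetP => y _.
  by move: xh; rewrite !inE h0 !mulmx0 !mxE.
have le1 : c * q `^ (f - 1 - eps) <= #|E :&: hyperplane h|%:R.
  apply: (bound_inside (Hc p pp) (aplane_hyperplane hneq)
     (VV := [set V :&: hyperplane h | V in G])).
  - by move=> _ /imsetP[V VG ->]; apply: G0.
  - by move=> _ /imsetP[V VG ->]; apply: subsetIr.
  - apply: (few_collisions_large_image (K := q ^+ k.+1) b8 _ _ _ _ _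
      (card_imset_collisions R (fun V : {set 'rV['F_p]_n.+1} =>
         V :&: hyperplane h) G)) => //.
    + rewrite powR_gt0 //= -powR_mulrn ?(ltW q0) //.
      by apply: ler_powR; [clear -q2; lra|rewrite -natr1].
    + by apply: le_trans hX; rewrite mulrAC ler_pM2r // invr_gt0 ltr0n.
    + apply: le_trans hC _; rewrite ler_pM2r ?invr_gt0 ?exprn_gt0 //.
      move: (#|VV|%:R : R) (#|G|%:R : R) N0 hX => N X N0 hX.
      by clear -N0 hX; rewrite !expr2; nra.
have -> : f - eps = 1 + (f - 1 - eps) by ring.
rewrite powD // powRr1 ?(ltW q0) // -/q in hS *.
have : q * (c * q `^ (f - 1 - eps)) <= q * #|E :&: hyperplane h|%:R.
  by rewrite ler_pM2l.
rewrite (_ : c / 8 * (q * q `^ (f - 1 - eps)) = q * (c * q `^ (f - 1 - eps)) / 8).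
  by lra.
by ring.
Qed.

(** * Lines: projecting to dimension two *)

(** The exponent that the planar bound gains over s. It is also the term of
    the index that depends on sigma and tau. *)
Definition planar_gain (R : realType) (s t : R) : R :=
  Num.min t (Num.min ((s + t) / 2) 1).

Lemma le_planar_gain (R : realType) (s t c : R) :
  (c <= planar_gain s t) = [&& c <= t, c <= (s + t) / 2 & c <= 1].
Proof. by rewrite !le_min. Qed.

Lemma planar_gain_le (R : realType) (s t : R) :
  [/\ planar_gain s t <= t, planar_gain s t <= (s + t) / 2 &
      planar_gain s t <= 1].
Proof. by apply/and3P; rewrite -le_planar_gain. Qed.

Lemma planar_gain_cases (R : realType) (s t : R) :
  [\/ planar_gain s t = t, planar_gain s t = (s + t) / 2 | planar_gain s t = 1].
Proof.
rewrite /planar_gain; case: (leP t) => _; first exact: Or31.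
by case: leP => _; [apply: Or32|apply: Or33].
Qed.

(** Here p^u lines collapse onto one, so t drops to t' = t - u, while the
    number of points per line rises to p^s' with s' the planar bound for p^u
    lines, capped by the size p of a line. The bound on u comes from
    averaging: when t <= 1 hardly any lines collapse. All losses are multiples
    of dl. *)
Lemma planar_gain_project (R : realType) (s t u dl s' t' : R) :
  0 < s <= 1 -> 0 < t <= 2 -> 0 <= dl -> 0 <= u ->
  (u <= dl \/ u <= t - 1 + dl) ->
  s' = Num.min 1 (s + planar_gain s u) - dl -> t' = t - u - dl ->
  s + planar_gain s t - 8 * dl <= s' + planar_gain s' t'.
Proof.
move=> s01 t02 dl0 u0 hu s'E t'E.
rewrite -lerBlDl le_planar_gain; have [g1 g2 g3] := planar_gain_le s t.
move: (planar_gain s t) g1 g2 g3 => g g1 g2 g3.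
have [h1 h2 h3] := planar_gain_le s u.
have : [\/ s' = 1 - dl, s' = s + u - dl, s' = s + (s + u) / 2 - dl |
   s' = s + 1 - dl].
  rewrite s'E; case: leP => _; first exact: Or41.
  by case: (planar_gain_cases s u) => ->; [apply: Or42|apply: Or43|apply: Or44].
have : s' <= s + planar_gain s u - dl.
  by rewrite s'E lerD2r ge_min lexx orbT.
have : s' <= 1 - dl by rewrite s'E lerD2r ge_min lexx.
move: (planar_gain s u) h1 h2 h3 => h h1 h2 h3 s'1 s'h cases; clear s'E.
subst t'; apply/and3P; split; case: cases => e; case: hu => hu; lra.
Qed.

(** Shifting v by a direction of V only slides each translate of V along
    itself. *)
Lemma cylinder_shift (F : finFieldType) (n : nat) (V : {set 'rV[F]_n}) v w a :
  V != set0 -> flat V -> w \in dirs V -> cylinder V (v + a *: w) = cylinder V v.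
Proof.
move=> V0 fV wV; apply/setP => x; rewrite !inE; apply: eq_existsb => c.
apply/idP/idP => xV.
  have := dirs_add (c * a) V0 fV wV xV; congr (_ \in V).
  by rewrite scalerDr scalerA opprD addrA subrK.
have := dirs_add (- (c * a)) V0 fV wV xV; congr (_ \in V).
by rewrite scalerDr scalerA opprD addrA scaleNr.
Qed.

Lemma dirs_shift (F : finFieldType) (n : nat) (V : {set 'rV[F]_n}) v w a :
  V != set0 -> flat V -> w \in dirs V -> (v + a *: w \in dirs V) = (v \in dirs V).
Proof.
move=> V0 fV wV; apply/idP/idP => vV; last exact: dirsZ.
by rewrite -[v](addrK (a *: w)) -scaleNr dirsZ.
Qed.

(** Fix a direction w of V and group the transversal directions v into the
    classes v + a w: the cylinder is the same throughout a class, and each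
    pair of its points is aligned with at most one of the #|F| members of the
    class. *)
Lemma collisions_few_on_average (R : realType) (F : finFieldType) (n k : nat)
    (E V : {set 'rV[F]_n}) : aplane k.+1 V ->
  \sum_(v in ~: dirs V) #|collisions_along (E :&: cylinder V v) v|%:R /
     #|E :&: cylinder V v|%:R ^+ 2 <= #|~: dirs V|%:R / #|F|%:R :> R.
Proof.
move=> pV; have [V0 fV cV] := pV.
have q0 : 0 < #|F|%:R :> R by rewrite ltr0n (leq_trans _ (finNzRing_gt1 F)).
have [w wV w0] : exists2 w, w \in dirs V & w != 0.
  have : (0 < #|dirs V :\ 0%R|)%N.
    rewrite -ltnS (card_nonzero_dirs pV) (leq_trans (finNzRing_gt1 F)) //.
    by rewrite -{1}[#|F|]expn1 leq_exp2l // finNzRing_gt1.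
  by case/card_gt0P => w; rewrite !inE => /andP[w0 wV]; exists w; rewrite // inE.
set I := ~: dirs V.
pose g v : R := #|collisions_along (E :&: cylinder V v) v|%:R /
     #|E :&: cylinder V v|%:R ^+ 2.
rewrite ler_pdivlMr // -/(g _).
(* Averaging over the classes v + a w leaves the sum unchanged. *)
have shift a : \sum_(v in I) g v = \sum_(v in I) g (v + a *: w).
  rewrite (reindex_inj (addIr (a *: w))) /=; apply: eq_bigl => v.
  by rewrite !in_setC dirs_shift.
have -> : (\sum_(v in I) g v) * #|F|%:R = \sum_(v in I) \sum_(a : F) g (v + a *: w).
  rewrite exchange_big /= mulr_natr -sumr_const.
  by apply: eq_bigr => a _; apply: shift.
rewrite -sumr_const; apply: ler_sum => v; rewrite in_setC => vV.
under eq_bigr do rewrite /g cylinder_shift //.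
rewrite -mulr_suml; set Q := E :&: _.
have [Q0|Q0] := eqVneq (#|Q|%:R : R) 0.
  by rewrite Q0 expr0n invr0 mulr0.
rewrite ler_pdivrMr ?mul1r ?exprn_gt0 ?lt0r ?Q0 ?ler0n //.
rewrite -natrX -mulnn -cardsX -natr_sum ler_nat.
have -> : (\sum_(a : F) #|collisions_along Q (v + a *: w)| =
    \sum_(a in [set: F]) #|[set xy in setX Q Q | (xy.1 != xy.2) &&
       [exists c, (xy.1 - xy.2 == c *: (v + a *: w))%R]]|)%N.
  by apply: eq_big => // a; rewrite inE.
rewrite double_count -sum1_card; apply: leq_sum => -[y z] _ /=.
rewrite leqNgt; apply/negP => /card_gt1P[a [b []]].
rewrite !inE /= => /andP[yz /existsP[c /eqP ec]] /andP[_ /existsP[d /eqP ed]].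
move=> /eqP ab; apply: ab.
have c0 : c != 0.
  by apply: contraNneq yz => c0; rewrite -subr_eq0 ec c0 scale0r.
have e : (c - d) *: v = (d * b - c * a) *: w.
  have := ec; rewrite ed !scalerDr !scalerA => e'.
  rewrite !scalerBl; apply/eqP; rewrite subr_eq addrAC -subr_eq opprK addrC.
  by rewrite e' addrC.
have [cd|cd] := eqVneq c d.
  move: e; rewrite cd subrr scale0r => /esym/eqP.
  rewrite scaler_eq0 (negbTE w0) orbF -mulrBr mulf_eq0 -cd (negbTE c0) /=.
  by rewrite subr_eq0 => /eqP.
case/negP: vV; have -> : v = 0 + ((c - d)^-1 * (d * b - c * a)) *: w.
  by rewrite add0r -scalerA -e scalerA mulVf ?scale1r // subr_eq0.
by apply: dirsZ => //; apply: dirs0.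
Qed.

(** The factors 8 leave room for Markov's inequality: each count may exceed an
    upper bound for its average over v by that factor. The second condition
    makes the projection of the part of E in the plane spanned by V and v
    large. *)
Definition good_projection (F : finFieldType) (n : nat) (E : {set 'rV[F]_n})
    (VV : {set {set 'rV[F]_n}}) V v :=
  [&& v \notin dirs V,
     (#|[set W in VV | (W != V) && (W \subset cylinder V v)]| * #|F| <= 8 * #|VV|)%N &
     (#|collisions_along (E :&: cylinder V v) v| * #|F| <=
      8 * #|E :&: cylinder V v| ^ 2)%N].

(** Markov's inequality for the two quantities in [good_projection]: the first
    is controlled by [card_cylinders_through], the second by
    [collisions_few_on_average]. *)
Lemma many_good_projections (R : realType) (p n : nat) (E V : {set 'rV['F_p]_n.+1})
    (VV : {set {set 'rV['F_p]_n.+1}}) :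
  prime p -> (2 <= n)%N -> V \in VV -> (forall W, W \in VV -> aplane 1 W) ->
  p%:R ^+ n.+1 / 4 <= #|[set v | good_projection E VV V v]|%:R :> R.
Proof.
move=> pp n2 VVV lines; have q2 := prime_ge2 R pp.
have pV := lines _ VVV; have [V0 fV cV] := pV.
rewrite (card_Fp pp) expn1 in cV.
set G := [set v | _]; set I := ~: dirs V.
set q : R := p%:R in q2 *; have q0 : 0 < q by lra.
set N : R := #|VV|%:R.
have N0 : 0 < N by rewrite ltr0n; apply/card_gt0P; exists V.
pose x1 v : R := #|[set W in VV | (W != V) && (W \subset cylinder V v)]|%:R.
pose x2 v : R := #|collisions_along (E :&: cylinder V v) v|%:R /
     #|E :&: cylinder V v|%:R ^+ 2.
have s1 : \sum_(v in I) x1 v <= N * q ^+ 2.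
  rewrite -natr_sum double_count natr_sum /N mulr_natl -sumr_const.
  apply: ler_sum => W WVV; rewrite -natrX ler_nat.
  have [->|WV] := eqVneq W V; first by rewrite eq_card0 // => v; rewrite !inE andbF.
  have nWV : ~~ (W \subset V).
    apply: contra WV => WV; rewrite eqEcard WV cV /=.
    by have [_ _ ->] := lines _ WVV; rewrite (card_Fp pp) expn1.
  have := card_cylinders_through V0 fV nWV; rewrite cV (card_Fp pp) mulnn.
  apply: leq_trans; apply: subset_leq_card; apply/subsetP => v.
  by rewrite !inE.
have s2 : \sum_(v in I) x2 v <= #|I|%:R / q.
  by have := collisions_few_on_average R E pV; rewrite (card_Fp pp).
have x20 v : 0 <= x2 v by rewrite divr_ge0 ?exprn_ge0.
have m1 := @markov_card R _ I x1 (8 * N / q) (fun _ _ => ler0n R _).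
have m2 := @markov_card R _ I x2 (8 / q) (fun _ _ => x20 _).
set B1 := [set i in I | _] in m1; set B2 := [set i in I | _] in m2.
have cI : #|I|%:R + q = q ^+ n.+1.
  have := cardsC (dirs V); rewrite (card_dirs V0 fV) cV card_row card_Fp //.
  by rewrite addrC /q -natrD -natrX => ->.
have h1 : 8 * #|B1|%:R <= q ^+ 3.
  have := le_trans m1 s1.
  rewrite (_ : _ * (8 * N / q) = N * (8 * #|B1|%:R / q)); last by ring.
  by rewrite ler_pM2l // ler_pdivrMr // -exprSr.
have h2 : 8 * #|B2|%:R <= #|I|%:R :> R.
  have := le_trans m2 s2.
  rewrite (_ : _ * (8 / q) = 8 * #|B2|%:R / q); last by ring.
  by rewrite ler_pM2r // invr_gt0.
have h3 : #|I|%:R <= #|B1|%:R + #|B2|%:R + #|G|%:R :> R.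
  rewrite -!natrD ler_nat.
  apply: leq_trans (_ : #|B1 :|: B2 :|: G| <= _)%N; last first.
    by rewrite (leq_trans (leq_card_setU _ _).1) // leq_add2r (leq_card_setU _ _).1.
  apply: subset_leq_card; apply/subsetP => v vI.
  have vV : v \notin dirs V by move: vI; rewrite in_setC.
  rewrite !in_setU [v \in B1]inE [v \in B2]inE [v \in G]inE vI /=.
  rewrite /good_projection vV /=.
  have [//|lt1] := leP (8 * N / q) (x1 v).
  have [|lt2] := leP (8 / q) (x2 v); first by rewrite orbT.
  rewrite /= -!(ler_nat R) -!mulnn !natrM -!expr2 !(card_Fp pp) -/q -/N -/(x1 v).
  apply/andP; split; first by rewrite -ler_pdivlMr // ltW.
  have [Q0|Q0] := eqVneq (#|E :&: cylinder V v|%:R : R) 0.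
    move/eqP: Q0; rewrite pnatr_eq0 cards_eq0 => /eqP ->.
    rewrite (_ : collisions_along set0 v = set0) ?cards0 ?mul0r ?expr0n ?mulr0 //.
    by apply/setP => xy; rewrite !inE.
  have Q1 : 0 < #|E :&: cylinder V v|%:R ^+ 2 :> R.
    by rewrite exprn_gt0 // lt0r Q0 ler0n.
  rewrite -ler_pdivlMr // mulrAC -ler_pdivrMr //.
  exact: ltW.
have h4 : q ^+ 3 <= q ^+ n.+1 by rewrite ler_eXn2l //; clear -q2; lra.
have h5 : 4 * q <= q ^+ n.+1.
  by apply: le_trans h4; clear -q2; rewrite !exprS expr0; nra.
move: h1 h2 h3 h4 h5 cI q0; move: (q ^+ 3) (q ^+ n.+1) => x y.
by clear; lra.
Qed.

(** Each line of G spans together with w a plane that contains between p^u and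
    p^v members of VV. The image of the line contains the projection of E in
    that whole plane, which is large by the planar bound for p^u lines; and at
    most p^v lines share an image. *)
Lemma project_lines_at_scale (R : realType) (n : nat) (s u v t s' f g : R) :
  furstenberg_bound 2 1 s u f -> furstenberg_bound n 1 s' (t - v) g ->
  s' <= 1 ->
  forall a b eps : R, 0 < a -> 0 < b -> 0 < eps -> s' <= f - eps ->
  exists c : R, 0 < c /\
    forall p, prime p ->
    forall (E : {set 'rV['F_p]_n.+1}) (VV G : {set {set 'rV['F_p]_n.+1}}) w,
      rich_family 1 (a * p%:R `^ s) E VV -> w != 0 -> G \subset VV ->
      (forall V, V \in G -> [/\ w \notin dirs V,
         (#|collisions_along (E :&: cylinder V w) w| * #|'F_p| <=
          8 * #|E :&: cylinder V w| ^ 2)%N &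
         p%:R `^ u <= #|[set W in VV | W \subset cylinder V w]|%:R < p%:R `^ v]) ->
      b * p%:R `^ t <= #|G|%:R ->
      c * p%:R `^ (g - eps) <= #|E|%:R.
Proof.
move=> H2 Hn s'1 a b eps a0 b0 e0 s'f.
have [c1 [c10 Hc1]] := H2 a 1 eps a0 ltr01 e0.
have a'0 : 0 < c1 / (1 + 8 * c1) by apply: divr_gt0 => //; lra.
have [c [c0 Hc]] := Hn _ b eps a'0 b0 e0.
exists c; split=> // p pp E VV G w rE w0 GVV hG cG.
have q2 := prime_ge2 R pp; set q : R := p%:R in q2 rE hG cG *.
have q0 : 0 < q by clear -q2; lra.
have q1 : 1 <= q by clear -q2; lra.
have [A pA] := exists_projection w0.
have lineG V : V \in G -> aplane 1 V by move=> /(subsetP GVV)/rE[].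
apply: le_trans (_ : #|mximage A E|%:R <= _); last first.
  by rewrite ler_nat; apply: leq_imset_card.
apply: (Hc p pp _ [set mximage A V | V in G]).
  move=> _ /imsetP[V VG ->]; have pV := lineG _ VG.
  have [wV cV /andP[pu _]] := hG _ VG.
  split; first exact: aplane_image_inj pV (projection_inj_on pA pV wV).
  have pC := aplane_cylinder pV wV.
  have big : c1 * q `^ (f - eps) <= #|E :&: cylinder V w|%:R.
    apply: (bound_inside (Hc1 p pp) pC
      (VV := [set W in VV | W \subset cylinder V w])).
    - by move=> W; rewrite inE => /andP[/rE].
    - by move=> W; rewrite inE => /andP[].
    - by rewrite mul1r.
  apply: le_trans (_ : #|mximage A (E :&: cylinder V w)|%:R <= _); last first.
    rewrite ler_nat subset_leq_card //; rewrite subsetI -(image_cylinder V pA).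
    by rewrite !imsetS ?subsetIl ?subsetIr.
  apply: (image_large (K := q) pA) => //.
  - rewrite powR_gt0 //= -[X in _ <= X]powRr1 ?(ltW q0) //.
    exact: ler_powR.
  - apply: le_trans big; rewrite ler_wpM2l ?(ltW c10) //.
    exact: ler_powR.
  - rewrite ler_pdivlMr // /q -[X in _ * X%:R <= _](card_Fp pp).
    by rewrite -natrX -!natrM ler_nat.
have fib W : W \in [set mximage A V | V in G] ->
    #|[set V in G | mximage A V == W]|%:R <= q `^ v.
  case/imsetP => V VG ->; have [wV _ /andP[_ /ltW]] := hG _ VG.
  apply: le_trans; rewrite ler_nat subset_leq_card //; apply/subsetP => W'.
  rewrite !inE => /andP[WG /eqP e]; rewrite (subsetP GVV) //=.
  exact: sub_cylinder_image pA e.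
rewrite powD // powRN mulrA ler_pdivrMr ?powR_gt0 //; apply: le_trans cG _.
rewrite -sum1_card (partition_big (fun V => mximage A V)
  (mem [set mximage A V | V in G])) /=; last by move=> V; apply: imset_f.
rewrite natr_sum mulr_natl -sumr_const; apply: ler_sum => W /fib.
by rewrite sum1dep_card.
Qed.

(** Up to constants the right-hand side is the average number of lines of the
    family in a plane; it is large only for t > 1. *)
Lemma scale_bound (R : realType) (q b t dl u : R) :
  2 <= q -> 0 < b -> 9 + 8 * b <= q `^ dl ->
  q `^ u <= 1 + 8 * (b + 1) * q `^ (t - 1) -> u <= dl \/ u <= t - 1 + dl.
Proof.
move=> q2 b0 qdl h; have q1 : 1 <= q by lra.
have [t1|t1] := leP t 1; [left|right]; apply: (pow_le_inv q2).
  apply: le_trans h _; apply: le_trans qdl.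
  have t10 : t - 1 <= 0 by lra.
  have := ler_powR q1 t10; rewrite powRr0 => h1.
  have : 8 * (b + 1) * q `^ (t - 1) <= 8 * (b + 1) * 1 by rewrite ler_wpM2l //; lra.
  by lra.
apply: le_trans h _; rewrite [leRHS]powD; last by lra.
have t10 : 0 <= t - 1 by lra.
have := ler_powR q1 t10; rewrite powRr0 => h1.
apply: le_trans (_ : q `^ (t - 1) * (9 + 8 * b) <= _); first by lra.
by rewrite ler_wpM2l ?powR_ge0.
Qed.

(** By averaging over directions and over scales, some direction is good for a
    positive proportion of the lines, at a single scale. *)
Lemma furstenberg_bound_lines (R : realType) (n : nat) : (2 <= n)%N ->
  (forall s t : R, 0 < s <= 1 -> 0 < t <= 2 ->
     furstenberg_bound 2 1 s t (s + planar_gain s t)) ->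
  (forall s t : R, 0 < s <= 1 -> 0 < t <= 2 ->
     furstenberg_bound n 1 s t (s + planar_gain s t)) ->
  forall s t : R, 0 < s <= 1 -> 0 < t <= 2 ->
     furstenberg_bound n.+1 1 s t (s + planar_gain s t).
Proof.
move=> n2 H2 Hn s t s01 t02; have /andP[s0 s1] := s01; have /andP[t0 t2] := t02.
apply: furstenberg_bound_large => a b eps a0 b0 e0.
(* The losses add up to 9 dl; the other bounds keep s' and t' positive. *)
pose dl : R := Num.min (eps / 16) (Num.min (s / 4) (Num.min (t / 4) (1 / 4))).
have [dl0 dle dls dlt dl1] :
    [/\ 0 < dl, dl <= eps / 16, dl <= s / 4, dl <= t / 4 & dl <= 1 / 4].
  rewrite /dl !lt_min !ge_min !lexx !orbT; split=> //.
  by rewrite !divr_gt0.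
pose J := (Num.truncn ((t + dl) / dl)).+1.
have Jdl : t + dl < J%:R * dl.
  by rewrite -ltr_pdivrMr //; apply: real_truncnS_gt; rewrite num_real.
pose u j : R := j%:R * dl.
pose s' j := Num.min 1 (s + planar_gain s (u j)) - dl.
pose t' j := t - (u j + dl).
have J0 : 0 < J%:R :> R by rewrite ltr0n.
have bJ : 0 < b / (4 * J%:R) by rewrite divr_gt0 // mulr_gt0.
pose Q j (c : R) := (u j <= dl \/ u j <= t - 1 + dl) ->
    forall p, prime p ->
    forall (E : {set 'rV['F_p]_n.+1}) (VV G : {set {set 'rV['F_p]_n.+1}}) w,
      rich_family 1 (a * p%:R `^ s) E VV -> w != 0 -> G \subset VV ->
      (forall V, V \in G -> [/\ w \notin dirs V,
         (#|collisions_along (E :&: cylinder V w) w| * #|'F_p| <=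
          8 * #|E :&: cylinder V w| ^ 2)%N &
         p%:R `^ (u j) <= #|[set W in VV | W \subset cylinder V w]|%:R
           < p%:R `^ (u j + dl)]) ->
      b / (4 * J%:R) * p%:R `^ t <= #|G|%:R ->
      c * p%:R `^ (s' j + planar_gain (s' j) (t' j) - dl) <= #|E|%:R.
have exQ j : exists c, 0 < c /\ Q j c.
  (* Only these scales occur, by [scale_bound]; for the others Q j is vacuous. *)
  have [hu|nu] := pselect (u j <= dl \/ u j <= t - 1 + dl); last first.
    by exists 1; split=> // /nu.
  have u0 : 0 <= u j by rewrite mulr_ge0 // ltW.
  have B2 : furstenberg_bound 2 1 s (u j) (s + planar_gain s (u j)).
    have [u00|u00] := ltP 0 (u j).
      by apply: H2 => //; rewrite u00; clear -hu dl1 t02; case: hu; lra.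
    have -> : u j = 0 by apply/eqP; rewrite eq_le u00.
    apply: furstenberg_bound_le (furstenberg_bound_trivial 2 1 s 0) _ _ _ => //.
    by rewrite /planar_gain gerDl ge_min lexx.
  have gain0 : 0 <= planar_gain s (u j).
    by rewrite /planar_gain !le_min u0 ler01 andbT divr_ge0 // addr_ge0 // ltW.
  have s'01 : 0 < s' j <= 1.
    rewrite /s'; clear -gain0 s01 dl0 dl1 dls.
    by have [[-> ?]|[-> ?]] := min_cases 1 (s + planar_gain s (u j));
       apply/andP; split; lra.
  have t'02 : 0 < t' j <= 2.
    by rewrite /t'; clear -hu dl1 dl0 u0 t02 dlt; case: hu; lra.
  have s'le : s' j <= s + planar_gain s (u j) - dl.
    by rewrite /s' lerD2r ge_min lexx orbT.
  have [c [c0 Hc]] := project_lines_at_scale B2 (Hn _ _ s'01 t'02)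
    (proj2 (andP s'01)) a0 bJ dl0 s'le.
  by exists c; split=> // _.
have antiQ j c c' : 0 < c' <= c -> Q j c -> Q j c'.
  move=> /andP[c'0 c'c] Hc hu p pp E VV G w rE w0 GV hG cG.
  apply: le_trans (Hc hu p pp E VV G w rE w0 GV hG cG).
  by rewrite ler_wpM2r ?powR_ge0.
have [c [c0 Hc]] := common_constant J antiQ exQ.
exists c; split=> //.
have [P HP] := pow_large (9 + 8 * b) dl0.
exists P => p pp /HP qdl E VV rE cV /(_ (ltW t0)) cV'.
have q2 := prime_ge2 R pp; set q : R := p%:R in q2 rE cV cV' qdl *.
have q0 : 0 < q by clear -q2; lra.
set N : R := #|VV|%:R in cV cV'.
have N0 : 0 < N by apply: lt_le_trans cV; rewrite mulr_gt0 ?powR_gt0.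
pose m V v : R := #|[set W in VV | W \subset cylinder V v]|%:R.
pose sc V v j := q `^ (u j) <= m V v < q `^ (u j + dl).
have lines V : V \in VV -> aplane 1 V by move=> /rE[].
have scale V v : V \in VV -> exists j : 'I_J, sc V v j.
  move=> VVV; have m1 : 1 <= m V v < q `^ (J%:R * dl).
    apply/andP; split.
      by rewrite ler1n; apply/card_gt0P; exists V; rewrite inE VVV sub_cylinder.
    rewrite ltNge; apply/negP => le.
    have : q `^ (J%:R * dl) <= q `^ (t + dl).
      apply: le_trans le _; apply: le_trans (_ : N <= _).
        by rewrite ler_nat subset_leq_card //; apply/subsetP => W; rewrite inE => /andP[].
      rewrite addrC powD //; apply: le_trans cV' _.
      rewrite ler_pM2r ?powR_gt0 //; clear -qdl b0; lra.
    by move=> /(pow_le_inv q2); clear -Jdl; lra.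
  have [|j jJ] := scale_of _ m1; first by clear -q2; lra.
  rewrite -natr1 mulrDl mul1r => h; by exists (Ordinal jJ).
pose G v (j : 'I_J) := [set V in VV | good_projection E VV V v && sc V v j].
pose I := [set: 'rV['F_p]_n.+1 * 'I_J].
have [[w j] _ hG] : exists2 vj, vj \in I & N / (4 * J%:R) <= #|G vj.1 vj.2|%:R.
  apply: average_ge.
    by apply/set0Pn; exists (0, ord0); rewrite inE.
  rewrite -natr_sum double_count natr_sum cardsT card_prod card_row.
  rewrite (card_Fp pp) card_ord natrM natrX -/q.
  rewrite (_ : _ * (N / (4 * J%:R)) = N * (q ^+ n.+1 / 4)); last first.
    by field; rewrite gt_eqF.
  rewrite /N mulr_natl -sumr_const; apply: ler_sum => V VVV.
  apply: le_trans (many_good_projections R E pp n2 VVV lines) _.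
  rewrite ler_nat.
  apply: leq_trans (leq_imset_card (fun vj : 'rV['F_p]_n.+1 * 'I_J => vj.1) _).
  apply: subset_leq_card; apply/subsetP => v; rewrite inE => gv.
  have [i hi] := scale V v VVV.
  by apply/imsetP; exists (v, i); rewrite // !inE gv.
have GVV : G w j \subset VV by apply/subsetP => V; rewrite inE => /andP[].
have [V0 V0G] : exists V, V \in G w j.
  by apply/card_gt0P; rewrite -(ltr0n R); apply: lt_le_trans hG; rewrite divr_gt0 ?mulr_gt0.
move: (V0G); rewrite inE => /and3P[V0V /and3P[wV0 cW _] /andP[um _]].
have w0 : w != 0 by apply: contraNneq wV0 => ->; apply: dirs0.
have hu : u j <= dl \/ u j <= t - 1 + dl.
  have mle : m V0 w <= 1 + 8 * (b + 1) * q `^ (t - 1).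
    have : m V0 w <= 1%N%:R + #|[set W in VV | (W != V0) && (W \subset cylinder V0 w)]|%:R.
      rewrite -natrD ler_nat (cardsD1 V0) leq_add ?leq_b1 //.
      by apply: subset_leq_card; apply/subsetP => W; rewrite !inE => /and3P[-> -> ->].
    move=> /le_trans; apply; rewrite lerD2l.
    move: cW; rewrite -(ler_nat R) !natrM (card_Fp pp) -/q -ler_pdivlMr // -/N.
    move=> /le_trans; apply; rewrite powD // powRN powRr1 ?(ltW q0) //.
    rewrite mulrA ler_pM2r ?invr_gt0 // -mulrA ler_pM2l //.
  exact: scale_bound q2 b0 qdl (le_trans um mle).
apply: le_trans (Hc j (ltn_ord j) hu p pp E VV (G w j) w rE w0 GVV _ _).
- have u0 : 0 <= u j by rewrite mulr_ge0 // ltW.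
  have := planar_gain_project s01 t02 (ltW dl0) u0 hu erefl erefl.
  rewrite -/(s' j) (_ : t - u j - dl = t' j); last by rewrite /t'; ring.
  move=> gain; apply: pow_le; rewrite ?lexx ?(ltW c0) //; first by clear -q2; lra.
  by clear -gain dle e0; lra.
- by move=> V; rewrite inE => /and3P[VVV /and3P[h1 _ h2] h3]; split.
- by apply: le_trans hG; rewrite mulrAC ler_pM2r ?invr_gt0 ?mulr_gt0.
Qed.

(** * The gain as a function of the number of planes *)

(** The planar gain, extended by 0 to negative arguments. It rises from 0 to 1
    within [0, 2] and is constant elsewhere. *)
Definition rise (R : realType) (sg x : R) : R := Num.max 0 (planar_gain sg x).

Lemma rise_spec (R : realType) (sg x : R) : 0 < sg <= 1 ->
  [/\ 0 <= rise sg x, rise sg x <= 1, x <= 0 -> rise sg x = 0,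
      2 <= x -> rise sg x = 1 & x <= 2 -> x - 2 * rise sg x <= sg].
Proof.
move=> sg01; have [g1 g2 g3] := planar_gain_le sg x.
have r0 : 0 <= rise sg x by rewrite le_max lexx.
split=> //; first by rewrite ge_max ler01.
- by move=> x0; apply: max_l; apply: le_trans x0.
- move=> x2; rewrite /rise max_r.
    by apply/eqP; rewrite eq_le g3 le_planar_gain; apply/and3P; split; lra.
  by rewrite le_planar_gain; apply/and3P; split; lra.
- move=> x2; have [xs|xs] := leP x sg; first by lra.
  have : (x - sg) / 2 <= planar_gain sg x.
    by rewrite le_planar_gain; apply/and3P; split; lra.
  have : planar_gain sg x <= rise sg x by rewrite le_max lexx orbT.
  lra.
Qed.

(** The minimum of functions that are nondecreasing with slope at most 1 has
    the same property, and so has its positive part. *)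
Lemma rise_mono_lip (R : realType) (sg x y : R) :
  x <= y -> rise sg x <= rise sg y <= rise sg x + (y - x).
Proof.
move=> xy; have [gx1 gx2 gx3] := planar_gain_le sg x.
have [gy1 gy2 gy3] := planar_gain_le sg y.
have xy1 : planar_gain sg x <= planar_gain sg y.
  by rewrite le_planar_gain; apply/and3P; split; lra.
have xy2 : planar_gain sg y - (y - x) <= planar_gain sg x.
  by rewrite le_planar_gain; apply/and3P; split; lra.
rewrite {1}/rise ge_max !le_max lexx xy1 orbT /=.
have r0 : 0 <= rise sg x by rewrite le_max lexx.
have rx : planar_gain sg x <= rise sg x by rewrite le_max lexx orbT.
rewrite {1}/rise ge_max; apply/andP; split; lra.
Qed.

(** With Q = d + 2 and t = Q m + tau this sums m full rises and one partial
    rise at tau, which is the part m + min(tau, (sigma + tau)/2, 1) of the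
    index; see [gain_at]. The finite sum is convenient because monotonicity
    and continuity need no case distinction on m. *)
Definition gain (R : realType) (sg Q : R) (L : nat) (t : R) : R :=
  \sum_(i < L) rise sg (t - Q * i%:R).

Lemma gain_recl (R : realType) (sg Q t : R) (L : nat) :
  gain sg Q L.+1 t = rise sg t + gain sg Q L (t - Q).
Proof.
rewrite /gain big_ord_recl mulr0 subr0; congr (_ + _); apply: eq_bigr => i _.
by rewrite /bump /= -nat1r mulrDr mulr1 opprD addrA.
Qed.

Lemma gain_nonpos (R : realType) (sg Q t : R) (L : nat) :
  0 < sg <= 1 -> 0 <= Q -> t <= 0 -> gain sg Q L t = 0.
Proof.
move=> sg01 Q0 t0; rewrite /gain big1 // => i _.
have [_ _ h _ _] := rise_spec (t - Q * i%:R) sg01; apply: h.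
by have : 0 <= Q * i%:R by [rewrite mulr_ge0]; lra.
Qed.

Lemma gain_ge0 (R : realType) (sg Q t : R) (L : nat) :
  0 < sg <= 1 -> 0 <= gain sg Q L t.
Proof. by move=> sg01; apply: sumr_ge0 => i _; case: (rise_spec (t - Q * i%:R) sg01). Qed.

Lemma gain_mono (R : realType) (sg Q x y : R) (L : nat) :
  x <= y -> gain sg Q L x <= gain sg Q L y.
Proof.
move=> xy; apply: ler_sum => i _.
have h : x - Q * i%:R <= y - Q * i%:R by lra.
by case/andP: (rise_mono_lip sg h).
Qed.

(** At each t at most one of the summands is growing, because each rises on an
    interval of length 2 and the intervals start at distance Q >= 2 from one
    another. *)
Lemma gain_lip (R : realType) (sg Q x y : R) (L : nat) :
  0 < sg <= 1 -> 2 <= Q -> x <= y -> gain sg Q L y <= gain sg Q L x + (y - x).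
Proof.
move=> sg01 Q2; elim: L x y => [|L IH] x y xy.
  by rewrite /gain !big_ord0; lra.
rewrite !gain_recl.
have /andP[_ lip] := rise_mono_lip sg xy.
have Q0 : 0 <= Q by lra.
have [yQ|Qy] := leP y Q.
  by rewrite !gain_nonpos //; lra.
have [_ _ _ ry _] := rise_spec y sg01.
have [Qx|xQ] := leP Q x.
  have [_ _ _ rx _] := rise_spec x sg01.
  have := IH (x - Q) (y - Q); rewrite rx ?ry; lra.
rewrite (@gain_nonpos _ _ _ (x - Q)) //; last lra.
have := IH 0 (y - Q); rewrite (@gain_nonpos _ _ _ 0) // => IH'.
have xQ' : x <= Q by lra.
have /andP[_] := rise_mono_lip sg xQ'.
have [_ _ _ rQ _] := rise_spec Q sg01; rewrite rQ // ry; lra.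
Qed.

(** The first summand is complete, and the last one has not begun. *)
Lemma gain_shift (R : realType) (sg Q t : R) (L : nat) :
  0 < sg <= 1 -> 2 <= Q -> Q <= t <= Q * L%:R ->
  gain sg Q L t = 1 + gain sg Q L (t - Q).
Proof.
move=> sg01 Q2 /andP[Qt tL]; have Q0 : 0 <= Q by lra.
case: L tL => [|L] tL; first by rewrite mulr0 in tL; lra.
rewrite gain_recl; have [_ _ _ r1 _] := rise_spec t sg01; rewrite r1; last by lra.
congr (_ + _); rewrite {2}/gain big_ord_recr /=.
have [_ _ r0 _ _] := rise_spec (t - Q - Q * L%:R) sg01.
rewrite r0 ?addr0 //; move: tL; rewrite -natr1 mulrDr mulr1; lra.
Qed.

Lemma gain_low (R : realType) (sg Q t : R) (L : nat) :
  0 < sg <= 1 -> 0 <= Q -> t <= Q -> gain sg Q L.+1 t = rise sg t.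
Proof.
by move=> sg01 Q0 tQ; rewrite gain_recl gain_nonpos ?addr0 // subr_le0.
Qed.

(** By [gain_lip] the function t - gain t is nondecreasing, so t may be
    replaced by the larger of x and Q. For x >= Q the claim is that the gain
    is at least 1 - sg; for x <= Q it is the bound x - 2 rise x <= sg of
    [rise_spec] or, beyond 2, immediate. *)
Lemma gain_tradeoff (R : realType) (sg Q x t : R) (L : nat) :
  0 < sg <= 1 -> 2 <= Q -> 0 <= x <= t -> Q <= t <= Q * L%:R ->
  x - 2 * gain sg Q L x <= t - gain sg Q L t + sg - 1.
Proof.
move=> sg01 Q2 /andP[x0 xt] /andP[Qt tL]; have Q0 : 0 <= Q by lra.
case: L tL => [|L] tL; first by rewrite mulr0 in tL; lra.
have rx : rise sg x <= gain sg Q L.+1 x.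
  by rewrite gain_recl lerDl gain_ge0.
have [r0 r1 _ r2 rs] := rise_spec x sg01.
have [xQ|Qx] := leP x Q.
  have := gain_lip L.+1 sg01 Q2 Qt; rewrite (@gain_low _ _ _ Q) //.
  have [_ _ _ r3 _] := rise_spec Q sg01; rewrite r3 //.
  have [x2|/ltW x2] := leP x 2; last by have := r2 x2; lra.
  by have := rs x2; lra.
have := gain_lip L.+1 sg01 Q2 xt.
have : 1 <= gain sg Q L.+1 x by rewrite -(r2 _) //; lra.
lra.
Qed.

(** * Hyperplanes containing many planes *)

(** If E has fewer than p r / 2 points, then every section in S exceeds the
    average #|E| / p by at least r / 2, and the variance bounds the number of
    such sections. *)
Lemma rich_hyperplanes (R : realType) (p n : nat) (E : {set 'rV['F_p]_n})
    (S : {set 'cV['F_p]_n * 'F_p}) (r : R) :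
  prime p -> 0 <= r ->
  (forall h, h \in S -> r <= #|E :&: hyperplane h|%:R) ->
  p%:R * r / 2 <= #|E|%:R \/ #|S|%:R * r ^+ 2 <= 4 * #|E|%:R * p%:R ^+ n.
Proof.
move=> pp r0 rS; have q2 := prime_ge2 R pp.
set q : R := p%:R in q2 *; set e : R := #|E|%:R; have q0 : 0 < q by lra.
have [|small] := leP (q * r / 2) e; [by left|right].
have er : e / q <= r / 2 by rewrite ler_pdivrMr //; lra.
have := section_variance R E pp; rewrite -/q -/e => var.
suff : #|S|%:R * (r / 2) ^+ 2 <= e * q ^+ n by rewrite !expr2; lra.
apply: le_trans var; rewrite mulr_natl -sumr_const.
rewrite [leRHS](bigID (mem S)) /=.
apply: le_trans (_ : \sum_(h in [set: 'cV['F_p]_n * 'F_p] | h \in S)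
    (#|E :&: hyperplane h|%:R - e / q) ^+ 2 <= _); last first.
  by rewrite lerDl sumr_ge0 // => h _; apply: sqr_ge0.
rewrite [leRHS](eq_bigl (fun h => h \in S)); last by move=> h; rewrite inE.
apply: ler_sum => h /rS rh; rewrite ler_pXn2r ?nnegrE //; lra.
Qed.

(** Each k-plane lies in p^(n+1-k) hyperplanes, one of which is given by the
    trivial equation. *)
Lemma sum_planes_in_hyperplanes (R : realType) (p n k : nat)
    (VV : {set {set 'rV['F_p]_n.+1}}) : prime p -> (k <= n)%N ->
  (forall V, V \in VV -> aplane k V) ->
  #|VV|%:R * p%:R ^+ n.+1 / 2 <=
    (\sum_(h in [set h : 'cV['F_p]_n.+1 * 'F_p | h.1 != 0])
       #|[set V in VV | V \subset hyperplane h]|%:R) * p%:R ^+ k :> R.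
Proof.
move=> pp kn lines; have q2 := prime_ge2 R pp.
set q : R := p%:R in q2 *; have q0 : 0 < q by lra.
rewrite -natr_sum double_count natr_sum mulr_suml -mulrA mulr_natl -sumr_const.
apply: ler_sum => V VVV.
have := card_hyperplanes_through (lines _ VVV); rewrite !(card_Fp pp).
set S := [set h | _]; set S' := [set h in _ | _] => cS.
have SS' : S \subset [set ((0, 0) : 'cV['F_p]_n.+1 * 'F_p)] :|: S'.
  apply/subsetP => -[a b]; rewrite !inE /= => Vh; rewrite Vh andbT.
  have [a0|_] := eqVneq a 0; last by rewrite orbT.
  have [/set0Pn[x xV] _ _] := lines _ VVV.
  have := subsetP Vh x xV; rewrite inE /= a0 mulmx0 mxE => /eqP <-.
  by rewrite xpair_eqE !eqxx.
have : (#|S| <= 1 + #|S'|)%N.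
  apply: leq_trans (subset_leq_card SS') _.
  by apply: leq_trans (leq_card_setU _ _).1 _; rewrite cards1.
rewrite -(ler_nat R) natrD => h1.
have h2 : #|S|%:R * q ^+ k = q ^+ n.+1 by rewrite /q -!natrX -natrM cS.
have h3 : 0 < q ^+ k by apply: exprn_gt0.
have h4 : 2 * q ^+ k <= q ^+ n.+1.
  rewrite [leRHS]exprS; apply: ler_pM => //; first exact: ltW.
  by rewrite ler_eXn2l //; lra.
have : #|S|%:R * q ^+ k <= (1 + #|S'|%:R) * q ^+ k by rewrite ler_pM2r.
by rewrite h2 mulrDl mul1r; lra.
Qed.

(** Hyperplanes that contain less than a quarter of the average number of
    planes contribute at most half of all inclusions. The rest is divided into
    scales, and a popular one is selected. *)
Lemma hyperplanes_at_scale (R : realType) (p n k J : nat) (dl : R)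
    (VV : {set {set 'rV['F_p]_n.+1}}) : prime p -> (k <= n)%N ->
  (forall V, V \in VV -> aplane k V) -> 0 < #|VV|%:R :> R ->
  #|VV|%:R < p%:R `^ (J.+1%:R * dl) ->
  exists (j : nat) (S : {set 'cV['F_p]_n.+1 * 'F_p}), [/\ (j < J.+1)%N,
    forall h, h \in S -> [/\ h.1 != 0,
      #|VV|%:R / (4 * p%:R ^+ k.+1) <=
        #|[set V in VV | V \subset hyperplane h]|%:R :> R &
      p%:R `^ (j%:R * dl) <= #|[set V in VV | V \subset hyperplane h]|%:R
        < p%:R `^ (j.+1%:R * dl)] &
    #|VV|%:R * p%:R ^+ n.+1 <=
      4 * J.+1%:R * #|S|%:R * p%:R `^ (j.+1%:R * dl) * p%:R ^+ k].
Proof.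
move=> pp kn lines; have q2 := prime_ge2 R pp.
set q : R := p%:R in q2 *; set N : R := #|VV|%:R => N0 NJ.
have q0 : 0 < q by lra.
have q1 : 1 <= q by lra.
pose x h : R := #|[set V in VV | V \subset hyperplane h]|%:R.
pose th : R := N / (4 * q ^+ k.+1).
have qk : 0 < q ^+ k by apply: exprn_gt0.
have th0 : 0 < th by rewrite divr_gt0 ?mulr_gt0 ?exprn_gt0.
pose I := [set h : 'cV['F_p]_n.+1 * 'F_p | (h.1 != 0) && (th <= x h)].
have sumI : N * q ^+ n.+1 / 4 <= (\sum_(h in I) x h) * q ^+ k.
  have := sum_planes_in_hyperplanes R pp kn lines; rewrite -/q -/N.
  rewrite (bigID (fun h => th <= x h)) /= mulrDl.
  rewrite (eq_bigl (fun h => h \in I)); last by move=> h; rewrite !inE.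
  set T := \sum_(_ in _ | _) _.
  have : T * q ^+ k <= N * q ^+ n.+1 / 4.
    have hT : T <= q ^+ n.+2 * th.
      apply: le_trans (_ : \sum_(h in [set: 'cV['F_p]_n.+1 * 'F_p]) th <= _).
        pose poor h := (h \in [set h : 'cV['F_p]_n.+1 * 'F_p | h.1 != 0]) &&
          ~~ (th <= x h).
        rewrite /T [leRHS](bigID poor) /= -[leLHS]addr0.
        apply: lerD; last by apply: sumr_ge0 => *; apply: ltW.
        rewrite [leRHS](eq_bigl poor); last by move=> h; rewrite in_setT.
        by apply: ler_sum => h /andP[_]; rewrite -ltNge => /ltW.
      rewrite sumr_const -[leLHS]mulr_natl cardsT card_prod card_col card_Fp //.
      by rewrite -expnSr natrX.
    apply: le_trans (_ : q ^+ n.+2 * th * q ^+ k <= _); first by rewrite ler_pM2r.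
    rewrite /th [q ^+ n.+2]exprS [q ^+ k.+1]exprS le_eqVlt; apply/orP; left.
    by apply/eqP; field; rewrite !gt_eqF.
  by lra.
pose sc h (j : 'I_J.+1) := q `^ (j%:R * dl) <= x h < q `^ (j.+1%:R * dl).
have [||j hj] := @sum_over_scales R _ I x J sc.
- by move=> h _; rewrite ler0n.
- move=> h; rewrite inE => /andP[_ hx].
  have [|j jJ hj] := @scale_of R q (x h) dl J.+1 q1.
    apply/andP; split.
      by rewrite ler1n -(ltr0n R); apply: lt_le_trans hx.
    apply: le_lt_trans NJ; rewrite ler_nat subset_leq_card //.
    by apply/subsetP => V; rewrite inE => /andP[].
  by exists (Ordinal jJ).
exists j, [set h in I | sc h j]; split=> //.
  by move=> h; rewrite !inE => /andP[/andP[h1 h2] h3].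
have hS : \sum_(h in I | sc h j) x h <=
    #|[set h in I | sc h j]|%:R * q `^ (j.+1%:R * dl).
  rewrite mulr_natl -sumr_const [leRHS](eq_bigl (fun h => (h \in I) && sc h j)).
    by apply: ler_sum => h /andP[_ /andP[_ /ltW]].
  by move=> h; rewrite inE.
have J0 : 0 < J.+1%:R :> R by rewrite ltr0n.
have h1 : (\sum_(h in I) x h) * q ^+ k <=
  J.+1%:R * (#|[set h in I | sc h j]|%:R * q `^ (j.+1%:R * dl)) * q ^+ k.
  rewrite ler_pM2r //; apply: le_trans hj _; rewrite ler_pM2l //.
by have := le_trans sumI h1; rewrite !mulrA; lra.
Qed.

(** Every hyperplane at a popular scale p^(u j) has at least r = c p^(s + gain
    (u j) - dl) points of E, by the bound in dimension n. The first
    alternative of [rich_hyperplanes] gives the exponent 1 + s + gain (t - Q),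
    up to dl, as u j is at least about t - Q; the second one is handled by
    [gain_tradeoff]. *)
Lemma furstenberg_bound_hyperplanes (R : realType) (n d L : nat) (sg : R) :
  (d.+1 <= n)%N -> 0 < sg <= 1 ->
  (forall t, 0 <= t <= d.+2%:R * L%:R ->
    furstenberg_bound n d.+1 (d%:R + sg) t (d%:R + sg + gain sg d.+2%:R L t)) ->
  forall t, d.+2%:R <= t <= d.+2%:R * L%:R ->
    furstenberg_bound n.+1 d.+1 (d%:R + sg) t (d%:R + sg + gain sg d.+2%:R L t).
Proof.
move=> dn sg01 H t /[dup] tQL /andP[Qt tL].
have Q2 : 2 <= d.+2%:R :> R by rewrite ler_nat.
have t0 : 0 <= t by lra.
set k := d.+1 in dn H *; set s : R := d%:R + sg in H *; set Q : R := d.+2%:R in H Qt tL tQL Q2 *.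
have kQ : k%:R + 1 = Q by rewrite natr1.
have sk : s - k%:R = sg - 1 by rewrite /s /k -natr1; ring.
pose phi := gain sg Q L.
have phi_shift : phi t = 1 + phi (t - Q) by apply: gain_shift.
apply: furstenberg_bound_large => a b eps a0 b0 e0.
pose dl : R := eps / 8; have dl0 : 0 < dl by rewrite divr_gt0.
pose J := Num.truncn ((t + dl) / dl).
have Jdl : t + dl < J.+1%:R * dl.
  by rewrite -ltr_pdivrMr // real_truncnS_gt // num_real.
(* The scale may exceed t by dl; capping it keeps it in the range where the
   bound in dimension n is available. *)
pose u j : R := Num.min (j%:R * dl) t.
have u0 j : 0 <= u j <= t.
  by rewrite le_min t0 ge_min lexx orbT andbT mulr_ge0 // ltW.
pose Qb j (c : R) := forall p, prime p ->
  forall (E : {set 'rV['F_p]_n}) (VV : {set {set 'rV['F_p]_n}}),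
      rich_family k (a * p%:R `^ s) E VV -> 1 * p%:R `^ (u j) <= #|VV|%:R ->
      c * p%:R `^ (s + phi (u j) - dl) <= #|E|%:R.
have exQ j : exists c, 0 < c /\ Qb j c.
  apply: (H (u j)) => //; have /andP[-> /le_trans] := u0 j; exact.
have antiQ j c c' : 0 < c' <= c -> Qb j c -> Qb j c'.
  move=> /andP[c'0 c'c] Hc p pp E VV rE cV.
  by apply: le_trans (Hc p pp E VV rE cV); rewrite ler_wpM2r ?powR_ge0.
have [c [c0 Hc]] := common_constant J.+1 antiQ exQ.
have J0 : 0 < J.+1%:R :> R by rewrite ltr0n.
have c1 : 0 < b * c ^+ 2 / (16 * J.+1%:R).
  by rewrite divr_gt0 ?mulr_gt0 ?exprn_gt0.
exists (Num.min (c / 2) (b * c ^+ 2 / (16 * J.+1%:R))); split.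
  by rewrite lt_min c1 andbT; lra.
have [P HP] := pow_large (b + 1 + 4 / b) dl0.
exists P => p pp /HP qdl E VV rE cV /(_ t0) cV'.
have q2 := prime_ge2 R pp; set q : R := p%:R in q2 rE cV cV' qdl *.
have q0 : 0 < q by clear -q2; lra.
set N : R := #|VV|%:R in cV cV'.
have N0 : 0 < N by apply: lt_le_trans cV; rewrite mulr_gt0 ?powR_gt0.
have b4 : 0 < 4 / b by rewrite divr_gt0.
have N_le : N <= q `^ (t + dl).
  rewrite addrC powD //; apply: le_trans cV' _; rewrite ler_pM2r ?powR_gt0 //.
  by apply: le_trans qdl; clear -b4; lra.
have NJ : N < q `^ (J.+1%:R * dl).
  rewrite ltNge; apply/negP => le.
  by have := le_trans le N_le => /(pow_le_inv q2); clear -Jdl; lra.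
have lines V : V \in VV -> aplane k V by move=> /rE[].
have [j [S [jJ hS cS]]] := hyperplanes_at_scale pp dn lines N0 NJ.
rewrite -/q -/N in hS cS.
pose r := c * q `^ (s + phi (u j) - dl).
have r0 : 0 < r by rewrite mulr_gt0 ?powR_gt0.
have rS h : h \in S -> r <= #|E :&: hyperplane h|%:R.
  move=> /hS[h1 _ /andP[h2 _]].
  apply: (bound_inside (Hc j jJ p pp) (aplane_hyperplane h1)
    (VV := [set V in VV | V \subset hyperplane h])).
  - by move=> V; rewrite inE => /andP[/rE].
  - by move=> V; rewrite inE => /andP[].
  - rewrite mul1r; apply: le_trans h2; apply: ler_powR; first by clear -q2; lra.
    by rewrite ge_min lexx.
have [h hS0] : exists h, h \in S.
  apply/card_gt0P; rewrite lt0n; apply: contraTneq cS => ->.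
  by rewrite mulr0 !mul0r -ltNge mulr_gt0 ?exprn_gt0.
have [_ hN /andP[uN Nu]] := hS h hS0.
set Nh : R := #|_|%:R in hN uN Nu.
have Nh_le : Nh <= N.
  by rewrite ler_nat subset_leq_card //; apply/subsetP => V; rewrite inE => /andP[].
have ujt : j%:R * dl <= u j + dl.
  have : j%:R * dl <= t + dl.
    by apply: (pow_le_inv q2); apply: le_trans uN (le_trans Nh_le N_le).
  rewrite /u; case: (min_cases (j%:R * dl) t) => [[-> _]|[-> _]] //.
  by move=> _; rewrite lerDl ltW.
(* A popular hyperplane contains at least about the average number of planes. *)
have lower : t - Q - 2 * dl <= u j.
  have le1 : q `^ (t - Q - dl) <= q `^ (j.+1%:R * dl).
    apply: le_trans (ltW Nu); apply: le_trans hN.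
    have qkQ : q ^+ k.+1 = q `^ Q by rewrite -powR_mulrn ?(ltW q0).
    have qk0 : 0 < 4 * q `^ Q by rewrite mulr_gt0 ?powR_gt0.
    rewrite qkQ ler_pdivlMr //; apply: le_trans cV.
    rewrite (_ : q `^ (t - Q - dl) * (4 * q `^ Q) =
       4 * (q `^ (t - Q - dl) * q `^ Q)); last by ring.
    rewrite -powD // (_ : t - Q - dl + Q = t - dl); last by ring.
    rewrite powD // powRN mulrA ler_pdivrMr ?powR_gt0 //.
    rewrite [leRHS]mulrAC ler_pM2r ?powR_gt0 //.
    have : b * (4 / b) <= b * q `^ dl.
      by rewrite ler_pM2l //; apply: le_trans qdl; clear -b0; lra.
    by rewrite mulrC divfK ?gt_eqF.
  have := pow_le_inv q2 le1; rewrite -natr1 mulrDl mul1r => h1.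
  rewrite /u; case: (min_cases (j%:R * dl) t) => [[-> _]|[-> _]].
    by clear -h1; lra.
  by clear -dl0 Q2; lra.
have u0j := u0 j.
have [caseA|caseB] := rich_hyperplanes pp (ltW r0) rS.
  apply: le_trans caseA; rewrite -/q /r.
  have -> : q * (c * q `^ (s + phi (u j) - dl)) / 2 =
      c / 2 * (q `^ 1 * q `^ (s + phi (u j) - dl)).
    by rewrite powRr1 ?(ltW q0) //; field.
  rewrite -powD //; apply: pow_le; first by clear -q2; lra.
    by rewrite ge_min lexx le_min (ltW c1) andbT; clear -c0; lra.
  rewrite -/(phi t) phi_shift.
  have [le|le] := leP (t - Q) (u j).
    by have : phi (t - Q) <= phi (u j); [apply: gain_mono|rewrite /dl; clear -e0; lra].
  have := gain_lip L sg01 Q2 (ltW le); rewrite -/(phi _) -/(phi _).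
  by move: lower; rewrite /dl; clear -e0; lra.
rewrite -/q in caseB.
have key : b * c ^+ 2 / (16 * J.+1%:R) *
   q `^ (t - k%:R - j.+1%:R * dl + ((s + phi (u j) - dl) + (s + phi (u j) - dl)))
   <= #|E|%:R.
  rewrite /r in caseB; move: (s + phi (u j) - dl) caseB => x caseB.
  rewrite [X in _ * X]powD // [q `^ (t - _ - _)]powD // [q `^ (t - _)]powD //.
  rewrite [q `^ (x + x)]powD // !powRN powR_mulrn ?(ltW q0) //.
  have K0 : 0 < q ^+ k by rewrite exprn_gt0.
  have M0 : 0 < q ^+ n.+1 by rewrite exprn_gt0.
  have A0 : 0 < q `^ x by rewrite powR_gt0.
  have D0 : 0 < q `^ (j.+1%:R * dl) by rewrite powR_gt0.
  move: (q `^ x) (q `^ (j.+1%:R * dl)) (q ^+ k) (q ^+ n.+1) (q `^ t) A0 D0 K0 M0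
    caseB cS cV => A D K M T A0 D0 K0 M0 caseB cS cV.
  have e1 : b * T * M * (c * A) ^+ 2 <= N * M * (c * A) ^+ 2.
    by rewrite ler_wpM2r ?sqr_ge0 // ler_wpM2r ?(ltW M0).
  have e2 : N * M * (c * A) ^+ 2 <= 4 * J.+1%:R * #|S|%:R * D * K * (c * A) ^+ 2.
    by rewrite ler_wpM2r ?sqr_ge0.
  have e3 : 4 * J.+1%:R * D * K * (#|S|%:R * (c * A) ^+ 2) <=
            4 * J.+1%:R * D * K * (4 * #|E|%:R * M).
    by rewrite ler_pM2l // !mulr_gt0.
  have e4 : b * T * (c * A) ^+ 2 * M <= 16 * J.+1%:R * #|E|%:R * K * D * M.
    rewrite (_ : b * T * (c * A) ^+ 2 * M = b * T * M * (c * A) ^+ 2); last by ring.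
    apply: le_trans e1 (le_trans e2 _).
    rewrite (_ : 4 * J.+1%:R * #|S|%:R * D * K * (c * A) ^+ 2 =
      4 * J.+1%:R * D * K * (#|S|%:R * (c * A) ^+ 2)); last by ring.
    by apply: le_trans e3 _; rewrite le_eqVlt; apply/orP; left; apply/eqP; ring.
  rewrite ler_pM2r // in e4.
  rewrite (_ : _ * _ = b * T * (c * A) ^+ 2 / (16 * J.+1%:R * K * D)).
    by rewrite ler_pdivrMr ?mulr_gt0 //; apply: le_trans e4 _;
       rewrite le_eqVlt; apply/orP; left; apply/eqP; ring.
  by field; rewrite nat1r !gt_eqF.
apply: le_trans key; apply: pow_le; first by clear -q2; lra.
  by rewrite ge_min lexx orbT le_min (ltW c1) andbT; clear -c0; lra.
have := gain_tradeoff sg01 Q2 u0j tQL; rewrite -/(phi _) -/(phi _).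
rewrite -natr1 mulrDl mul1r; move: ujt sk; rewrite /dl; clear -e0; lra.
Qed.

(** * Reduction of the general case *)

(** The union of the sets E :&: V is a Furstenberg set in the strict sense,
    with lambda the least of 1, a and b. *)
Lemma furstenberg_bound_planar (R : realType) (s t : R) :
  planar_furstenberg_conjecture R -> 0 < s <= 1 -> 0 < t <= 2 ->
  furstenberg_bound 2 1 s t (s + planar_gain s t).
Proof.
move=> conj s01 t02 a b eps a0 b0 e0.
pose lam := Num.min 1 (Num.min a b).
have lam01 : 0 < lam <= 1 by rewrite /lam !lt_min ge_min lexx ltr01 a0 b0.
have lama : lam <= a by rewrite /lam !ge_min lexx !orbT.
have lamb : lam <= b by rewrite /lam !ge_min lexx !orbT.
have [c [c0 Hc]] := conj s t lam eps s01 t02 lam01 e0.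
exists c; split=> // p pp E VV rE cV; have q2 := prime_ge2 R pp.
have -> : s + planar_gain s t =
    Num.min (s + t) (Num.min (3%:R / 2%:R * s + 1 / 2%:R * t) (s + 1)).
  have -> : 3%:R / 2%:R * s + 1 / 2%:R * t = s + (s + t) / 2 by field.
  by rewrite -!addr_minr.
apply: le_trans (Hc p pp (\bigcup_(V in VV) (E :&: V)) _) _.
  exists VV, (fun V => E :&: V); split=> //.
  - by move=> V /rE[/kplaneE].
  - by apply: le_trans cV; rewrite ler_wpM2r ?powR_ge0.
  - move=> V /rE[_ mV]; split; first exact: subsetIr.
    by apply: le_trans mV; rewrite ler_wpM2r ?powR_ge0.
by rewrite ler_nat subset_leq_card //; apply/bigcupsP => V _; apply: subsetIl.
Qed.

Lemma furstenberg_bound_all_lines (R : realType) (n : nat) (s t : R) :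
  planar_furstenberg_conjecture R -> (2 <= n)%N -> 0 < s <= 1 -> 0 < t <= 2 ->
  furstenberg_bound n 1 s t (s + planar_gain s t).
Proof.
move=> conj; elim: n s t => // n IH s t n2 s01 t02.
have [->|n_neq] := eqVneq n 1%N; first exact: furstenberg_bound_planar.
have {}n2 : (2 <= n)%N by rewrite ltn_neqAle eq_sym n_neq -ltnS.
apply: (furstenberg_bound_lines n2 _ _ s01 t02) => s' t' hs ht.
  exact: furstenberg_bound_planar.
exact: (IH s' t' n2 hs ht).
Qed.

(** Slicing d times turns the planes into lines; each slice applies because t
    <= 2 does not exceed the dimension of the planes that are cut. *)
Lemma furstenberg_bound_sparse (R : realType) (d n : nat) (sg t : R) :
  planar_furstenberg_conjecture R -> (d.+2 <= n)%N -> 0 < sg <= 1 -> 0 < t <= 2 ->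
  furstenberg_bound n d.+1 (d%:R + sg) t (d%:R + sg + planar_gain sg t).
Proof.
move=> conj; elim: d n => [|d IH] [//|n] dn sg01 t02.
  by rewrite add0r; apply: furstenberg_bound_all_lines.
have dd : d.+1%:R = d%:R + 1 :> R by rewrite -natr1.
have d0 : 0 <= d%:R :> R by [].
apply: furstenberg_bound_slice => //; rewrite ?dd; try lra.
have -> : d%:R + 1 + sg - 1 = d%:R + sg by ring.
have -> : d%:R + 1 + sg + planar_gain sg t - 1 = d%:R + sg + planar_gain sg t by ring.
exact: IH.
Qed.

(** There is only one n-plane in dimension n, while the family would have to
    grow with p. *)
Lemma furstenberg_bound_full (R : realType) (n : nat) (s t f : R) :
  0 < t -> furstenberg_bound n n s t f.
Proof.
move=> t0; apply: furstenberg_bound_large => a b eps a0 b0 e0.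
exists 1; split=> //; have [P HP] := pow_large (2 / b) t0; exists P.
move=> p pp /HP qt E VV rE cV _.
have : #|VV|%:R <= 1 :> R.
  apply: le_trans (_ : #|[set [set: 'rV['F_p]_n]]|%:R <= _); last by rewrite cards1.
  rewrite ler_nat subset_leq_card //.
  apply/subsetP => V /rE[[_ _ cV'] _]; rewrite inE eqEcard subsetT.
  by rewrite cV' cardsT card_row leqnn.
have : b * (2 / b) <= b * p%:R `^ t by rewrite ler_pM2l.
rewrite mulrC divfK ?gt_eqF //; lra.
Qed.

(** Induction on n from the vacuous case n = d+1. For t <= d+2 only the first
    rise is present and the sparse case applies; the remaining range is
    reached through hyperplanes. *)
Lemma furstenberg_bound_gain (R : realType) (d n L : nat) (sg t : R) :
  planar_furstenberg_conjecture R -> (d.+1 <= n)%N -> 0 < sg <= 1 ->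
  0 <= t <= d.+2%:R * L.+1%:R ->
  furstenberg_bound n d.+1 (d%:R + sg) t (d%:R + sg + gain sg d.+2%:R L.+1 t).
Proof.
move=> conj dn sg01; have Q2 : 2 <= d.+2%:R :> R by rewrite ler_nat.
have Q0 : 0 <= d.+2%:R :> R by [].
elim: n dn t => [//|n IH] dn t /[dup] tQL /andP[t0 tL].
have [t00|tpos] := leP t 0.
  rewrite gain_nonpos // addr0; exact: furstenberg_bound_trivial.
have [en|nd] := eqVneq n d; first by rewrite en; apply: furstenberg_bound_full.
have dn1 : (d < n)%N by rewrite ltn_neqAle eq_sym nd -ltnS.
have dn2 : (d.+2 <= n.+1)%N by [].
have [Qt|tQ] := leP d.+2%:R t.
  apply: furstenberg_bound_hyperplanes => //; last by rewrite Qt.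
  by move=> t' ht'; apply: IH.
have pos x : 0 < x -> rise sg x = planar_gain sg x.
  move=> x0; rewrite /rise max_r // /planar_gain !le_min; lra.
rewrite gain_low ?(ltW tQ) //.
have [t2|/ltW t2] := leP t 2.
  by rewrite pos //; apply: furstenberg_bound_sparse => //; rewrite tpos.
have [_ _ _ r1 _] := rise_spec t sg01; have [_ _ _ r2 _] := rise_spec 2 sg01.
have two : 0 < (2 : R) <= 2 by lra.
have := furstenberg_bound_sparse conj dn2 sg01 two.
rewrite -pos ?r1 ?r2 ?lexx // => h.
by apply: furstenberg_bound_le h _ t2 _.
Qed.

Lemma furstenberg_bound_project_iter (R : realType) (j n k : nat) (s t f : R) :
  s <= k%:R -> furstenberg_bound n k s (t - j%:R * (n%:R - k%:R)) f ->
  furstenberg_bound (n + j) (k + j) s t f.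
Proof.
move=> sk; elim: j t => [|j IH] t; first by rewrite mul0r subr0 !addn0.
move=> H; rewrite !addnS; apply: furstenberg_bound_project.
  by apply: le_trans sk _; rewrite ler_nat leq_addr.
apply: IH; congr furstenberg_bound: H; rewrite !natrD -natr1; ring.
Qed.

Lemma lower_index_itv (R : realType) (x : R) :
  0 < x -> (lower_index x)%:R < x <= (lower_index x).+1%:R.
Proof.
move=> x0; have c0 : 0 < Num.ceil x by rewrite ceil_gt0.
have [q eq] : exists q : nat, Num.ceil x = q.+1%:Z.
  by case: (Num.ceil x) c0 => // -[//|q] _; exists q.
have := real_ceil_itv (num_real x); rewrite /lower_index eq /=.
rewrite intrB -!pmulrn => /andP[h ->]; rewrite andbT.
by move: h; rewrite -natr1; lra.
Qed.

Lemma gain_at (R : realType) (sg Q tau : R) (m : nat) :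
  0 < sg <= 1 -> 2 <= Q -> 0 < tau <= Q ->
  gain sg Q m.+1 (Q * m%:R + tau) = m%:R + planar_gain sg tau.
Proof.
move=> sg01 Q2 /andP[tau0 tauQ]; elim: m => [|m IH].
  rewrite mulr0 !add0r gain_low //; last by lra.
  by rewrite /rise max_r // /planar_gain !le_min; lra.
rewrite gain_recl.
have -> : Q * m.+1%:R + tau - Q = Q * m%:R + tau by rewrite -natr1; ring.
have [_ _ _ r1 _] := rise_spec (Q * m.+1%:R + tau) sg01.
rewrite r1 ?IH -?natr1; first by ring.
have : 0 <= Q * m%:R by rewrite mulr_ge0 //; lra.
lra.
Qed.

(** With j = k - d - 1 projections the parameters become (n - j, d + 1) and t
    - t0 = (d + 2) m + tau, and the index is s plus the gain there. *)
Lemma furstenberg_bound_index (R : realType) (n k : nat) (s t : R) :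
  planar_furstenberg_conjecture R -> (1 <= k)%N -> (k < n)%N -> 0 <= s <= k%:R ->
  furstenberg_bound n k s t (furstenberg_index s t n k).
Proof.
move=> conj k1 kn /andP[s0 sk]; rewrite /furstenberg_index.
have [->|s_neq] := eqVneq s 0.
  case: (leP (t - k%:R * (n%:R - k%:R)) 0) => _.
    exact: furstenberg_bound_trivial.
  have -> : furstenberg_bound n k 0 t = furstenberg_bound (n - k + k) (0 + k) 0 t.
    by rewrite subnK // ltnW.
  apply: furstenberg_bound_project_iter => //.
  rewrite natrB ?(ltnW kn) // subr0; exact: furstenberg_bound_points.
have {s_neq}s0 : 0 < s by rewrite lt0r s_neq.
have /andP[ds sd] := lower_index_itv s0; set d := lower_index s in ds sd *.
set t0 := _ * _; case: (leP t t0) => [_|tt0]; first exact: furstenberg_bound_trivial.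
have dk : (d < k)%N by rewrite -(ltr_nat R); apply: lt_le_trans ds sk.
have d2 : 0 < d%:R + 2 :> R by rewrite ltr_wpDl.
have tt00 : 0 < t - t0 by rewrite subr_gt0.
have := lower_index_itv (divr_gt0 tt00 d2).
set m := lower_index _; rewrite ltr_pdivlMr // ler_pdivrMr // -natr1 => /andP[mt tm].
set tau := t - t0 - _; set sg := s - d%:R.
have sE : s = d%:R + sg by rewrite /sg; ring.
have sg01 : 0 < sg <= 1 by rewrite /sg; move: sd; rewrite -natr1; lra.
have QE : d.+2%:R = d%:R + 2 :> R by rewrite -!natr1; ring.
have Q2 : 2 <= d.+2%:R :> R by rewrite ler_nat.
have tau0 : 0 < tau <= d.+2%:R by rewrite QE /tau; lra.
have tE : t - t0 = d.+2%:R * m%:R + tau by rewrite QE /tau; ring.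
pose j := (k - d.+1)%N.
have kE : k = (d.+1 + j)%N by rewrite subnKC.
have nE : n = (n - j + j)%N.
  by rewrite subnK // (leq_trans (leq_subr _ _) (ltnW kn)).
rewrite {1}kE {1}nE; apply: furstenberg_bound_project_iter; first by rewrite -natr1; lra.
have -> : t - j%:R * ((n - j)%:R - d.+1%:R) = d.+2%:R * m%:R + tau.
  rewrite -tE /t0; congr (t - _).
  have kR : k%:R = d%:R + 1 + j%:R :> R by rewrite natr1 -natrD -kE.
  have nR : n%:R = (n - j)%:R + j%:R :> R by rewrite -natrD -nE.
  by rewrite kR nR -natr1; ring.
have -> : s + m%:R + Num.min tau (Num.min ((sg + tau) / 2%:R) 1) =
   d%:R + sg + gain sg d.+2%:R m.+1 (d.+2%:R * m%:R + tau).
  by rewrite (gain_at m sg01 Q2 tau0) -addrA; congr (_ + _).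
rewrite [X in furstenberg_bound _ _ X]sE; apply: furstenberg_bound_gain => //.
  by rewrite -(leq_add2r j) -nE -kE ltnW.
case/andP: tau0 => h1 h2; rewrite addr_ge0 ?mulr_ge0 ?(ltW h1) //=.
by rewrite -[m.+1%:R]natr1 mulrDr mulr1 lerD2l.
Qed.

Theorem theorem1p8 (R : realType) (n k : nat) (s t : R) :
  planar_furstenberg_conjecture R ->
  (1 <= k)%N -> (k < n)%N ->
  0 <= s <= k%:R ->
  0 <= t <= (k%:R + 1) * (n%:R - k%:R) ->
  forall lambda eps : R, 0 < lambda <= 1 -> 0 < eps ->
  exists c : R, 0 < c /\
    forall p : nat, prime p ->
    forall E : {set 'rV['F_p]_n}, furstenberg_set k s t lambda E ->
      c * p%:R `^ (furstenberg_index s t n k - eps) <= #|E|%:R.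
Proof.
move=> conj k1 kn sk _ lambda eps /andP[l0 _] e0.
have [c [c0 Hc]] := furstenberg_bound_index t conj k1 kn sk l0 l0 e0.
exists c; split=> // p pp E [VV [Y [pV cV YV ->]]].
apply: (Hc p pp _ VV) cV => V VVV; have [YsubV mY] := YV _ VVV.
split; first by apply/kplaneE; apply: pV.
apply: le_trans mY _; rewrite ler_nat subset_leq_card // subsetI YsubV andbT.
exact: (bigcup_sup V).
Qed.
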